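(* Let $G_m=(V_m,E_m)$, $m\in\mathbb N$, be a sequence of finite connected $d_m$-regular graphs of increasing sizes $n_m=|V_m|$, with edge rates $r_e^{(m)}\equiv\frac1{d_m}$. There exist constants $c,c'>0$ such that for all $\delta_m\in(0,1/5)$, if $\frac{1}{c_{\mathrm{LS}}(G_m)}\le c\,\delta_m\,t_{\mathrm{rel}}(G_m)\log n_m$ for all $m$, then $$t_{\mathrm{mix}}^{\mathrm{EX}(k_m),G_m}\ge c'\bigl(t_{\mathrm{mix}}^{\mathrm{RW}(1),G_m}\vee\delta_m\,t_{\mathrm{rel}}(G_m)\log n_m\bigr)$$ for all $m$ and all $k_m\in[n_m^{5\delta_m},\frac{n_m}{2}]$.
   Context: For a finite connected graph $G=(V,E)$, each edge $e$ rings at the times of an independent rate-$r_e$ Poisson process. $\mathrm{EX}(k)$ (symmetric exclusion process): continuous-time Markov chain on $k$-subsets of $V$ (occupied sites); when $e$ rings, the contents (occupied/vacant) of the endpoints of $e$ are swapped; stationary law uniform on $\binom Vk$. $\mathrm{RW}(1)$: continuous-time random walk on $V$ jumping across each incident edge $e$ at rate $r_e$; stationary law $\pi$ uniform on $V$. $t_{\mathrm{mix}}^{Q}$ is the least $t$ such that, from every initial state, the law of $Q$ at time $t$ is within total variation distance $1/4$ of the stationary law. A superscript or argument $G_m$ indicates the underlying graph. $\mathcal L$ is the generator of $\mathrm{RW}(1)$; $t_{\mathrm{rel}}=1/\mathrm{gap}$, $\mathrm{gap}$ the smallest positive eigenvalue of $-\mathcal L$. $\mathcal E(h,h)=\frac12\sum_{x,y}\pi(x)\mathcal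 L(x,y)(h(x)-h(y))^2$. The log-Sobolev constant is $c_{\mathrm{LS}}=\inf\{\mathcal E(h,h)/\mathrm{Ent}_\pi(h^2): h^2\in(0,\infty)^V,\ \mathrm{Ent}_\pi(h^2)\ne0\}$, where $\mathrm{Ent}_\pi(g)=\mathbb E_\pi[g\log(g/\|g\|_1)]$ and $\|g\|_1=\mathbb E_\pi|g|$. $a\vee b=\max\{a,b\}$. *)

(* Defs.v *)
From HB Require Import structures.
From mathcomp Require Import all_boot all_order all_algebra all_fingroup.
From mathcomp Require Import all_classical all_reals all_analysis.

Set Implicit Arguments.
Unset Strict Implicit.
Unset Printing Implicit Defensive.

Import Order.TTheory GRing.Theory Num.Theory.
Import numFieldNormedType.Exports.

Local Open Scope classical_set_scope.
Local Open Scope ring_scope.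

Section MarkovChain.
Variables (R : realType) (S : finType).

(* [q x y], for [x != y], is the jump rate from [x] to [y]; the diagonal of
   [q] is ignored. *)
Definition generator (q : S -> S -> R) (x y : S) : R :=
  if x == y then - \sum_(z | z != x) q x z else q x y.

Definition generator_mx (q : S -> S -> R) : 'M[R]_#|S| :=
  \matrix_(i, j) generator q (enum_val i) (enum_val j).

(* Entry [(x, y)] of the matrix exponential [exp (t L)]: the probability that
   the chain started at [x] is at [y] at time [t]. *)
Definition transition (q : S -> S -> R) (t : R) (x y : S) : R :=
  limn (series (fun j : nat =>
    exp_coeff t j * (generator_mx q ^+ j) (enum_rank x) (enum_rank y))).

Definition unif (x : S) : R := #|S|%:R^-1.

Definition tv_dist (mu nu : S -> R) : R := 2^-1 * \sum_x `|mu x - nu x|.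

(* For chains whose stationary law is uniform. *)
Definition tmix (q : S -> S -> R) : R :=
  inf [set t : R | 0 <= t /\
                   forall x, tv_dist (transition q t x) unif <= 1 / 4].

Definition gap (q : S -> S -> R) : R :=
  inf [set l : R | 0 < l /\ eigenvalue (- generator_mx q) l].

Definition trel (q : S -> S -> R) : R := 1 / gap q.

Definition dirichlet (q : S -> S -> R) (h : S -> R) : R :=
  2^-1 * \sum_x \sum_y unif x * generator q x y * (h x - h y) ^+ 2.

Definition expect (g : S -> R) : R := \sum_x unif x * g x.

Definition entropy (g : S -> R) : R :=
  expect (fun x => g x * ln (g x / expect (fun y => `|g y|))).

(* On a one-point space no [h] is admissible and the infimum is [+oo]; here
   [inf set0 = 0], so that [1 / logsob q = 0] as it should. *)
Definition logsob (q : S -> S -> R) : R :=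
  inf [set r : R | exists h : S -> R,
    [/\ forall x, 0 < h x ^+ 2,
        entropy (fun x => h x ^+ 2) != 0 &
        r = dirichlet q h / entropy (fun x => h x ^+ 2)]].

End MarkovChain.

Definition connected_regular_graph (V : finType) (e : rel V) (d : nat) : Prop :=
  [/\ symmetric e, irreflexive e, (0 < #|V|)%N,
      forall x y, connect e x y & forall x, #|e x| = d].

Section Exclusion.
Variables (R : realType) (V : finType) (e : rel V) (d : nat).

(* The rate of the edge [{x, y}] (and 0 for non-edges), which is also the jump
   rate of RW(1) from [x] to [y]. *)
Definition rw_rate (x y : V) : R := if e x y then 1 / d%:R else 0.

(* Jump rates of EX(k).  When the edge [{x, y}] rings, the set [A] of occupied
   sites becomes [tperm x y @: A].  The factor 1/2 is there because the sum
   over ordered pairs counts each edge twice. *)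
Definition ex_rate (k : nat) (A B : {A : {set V} | #|A| == k}) : R :=
  2^-1 * \sum_x \sum_(y | tperm x y @: val A == val B) rw_rate x y.

End Exclusion.

(* Main.v *)
Require Import Defs.
From mathcomp Require Import all_boot all_order all_algebra all_fingroup.
From mathcomp Require Import all_classical all_reals all_analysis.
From mathcomp Require Import ring lra.
From mathcomp.real_closed Require complex.

(** The chains are reversible with uniform stationary law, and a sum
    [F_f(A)] of a function [f] over the occupied sites evolves in mean like the
    random walk: its mean from [A] at time [t] is the sum over [A] of [P_t f],
    where [P] is the semigroup of RW(1).  Its variance is at most that of [k]
    independent walkers started from [A] ([ex_variance]).  Write [n = #|V|]
    and let [t] be a time at which EX(k) is mixed.  Laws of the process started
    from two sets then overlap, so their means cannot be many standard
    deviations apart; comparing [A] with a well chosen set gives, for [f] of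
    mean zero,
      [(sum over A of P_t f) ^ 2 <= 6 (sum over A of P_t (f ^ 2) + k E (f ^ 2))]
    ([ex_mean_bound]).  The two lower bounds follow from this inequality.

    Relaxation time.  Let [f] be a normalised eigenfunction for the gap.  The
    log-Sobolev inequality applied to [f] itself bounds the entropy of [f ^ 2]
    by [gap / logsob], at most [c delta ln n] by hypothesis; hence [f ^ 2]
    cannot concentrate on few points, and up to sign [f >= 1/4] on at least
    about [n ^ (1 - 4 c delta)] points ([spread_eigenfunction]).  Some [k]-set
    thus has a large sum of [f] while the sum of [P_t (f ^ 2)] over it is not
    much larger than average ([spread_subset]), and the inequality forces
    [expR (gap * t)] to be at least a power [n ^ (delta / 4)].

    Random walk.  Take for [f] the centered indicator of a set [B].  The points
    from which the walk sees [B] too often at time [t] are fewer than [k], and a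
    set of [k] points is missed by the walk at time [t] with probability at
    least 1/4 ([ex_hit]).  So at time [2 t] the walk is at distance at most 7/8
    from stationarity ([rw_overlap]).  Such a bound alone does not give distance
    1/4 after a bounded multiple of [t], but it does together with a bounded
    multiple of the relaxation time ([rw_mixed]): each further interval [2 t]
    makes an eighth of what is left of the law have bounded density with respect
    to the uniform one, and laws with bounded density relax at the rate [gap].
    Finally [logsob <= gap] turns the hypothesis into [1 <= c delta ln n], so
    the relaxation time is itself controlled by the first bound.

    Two degenerate values have to be excluded on the way: [logsob] is positive,
    so that its inverse is meaningful, and EX(k) does mix, so that the infimum
    defining its mixing time is not that of the empty set. *)

Set Implicit Arguments.
Unset Strict Implicit.
Unset Printing Implicit Defensive.

Import Order.TTheory GRing.Theory Num.Theory.
Import numFieldNormedType.Exports.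

Local Open Scope ring_scope.

(** * Averages, total variation and subsets of a finite set *)

Section Expect.
Variables (R : realType) (S : finType).
Implicit Types (f g : S -> R).
Local Notation n := (#|S|%:R : R).

Lemma eq_expect f g : f =1 g -> expect f = expect g.
Proof. by move=> fg; apply: eq_bigr => x _; rewrite fg. Qed.

Lemma expectD f g : expect (fun x => f x + g x) = expect f + expect g.
Proof. by rewrite /expect -big_split; apply: eq_bigr => x _; rewrite mulrDr. Qed.

Lemma expectZ a f : expect (fun x => a * f x) = a * expect f.
Proof. by rewrite /expect mulr_sumr; apply: eq_bigr => x _; rewrite mulrCA. Qed.

Lemma le_expect f g : (forall x, f x <= g x) -> expect f <= expect g.
Proof.
by move=> fg; rewrite ler_sum // => x _; rewrite ler_wpM2l // /unif invr_ge0.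
Qed.

Lemma expect_ge0 f : (forall x, 0 <= f x) -> 0 <= expect f.
Proof.
by move=> f0; rewrite sumr_ge0 // => x _; rewrite mulr_ge0 // /unif invr_ge0.
Qed.

Hypothesis S_gt0 : (0 < #|S|)%N.

Lemma expect_sum f : \sum_x f x = n * expect f.
Proof.
rewrite /expect /unif -mulr_sumr mulrA divff ?mul1r //.
by rewrite pnatr_eq0 -lt0n.
Qed.

Lemma expect_cst (a : R) : expect (fun _ : S => a) = a.
Proof.
rewrite /expect /unif sumr_const -mulrnAr -[a *+ _]mulr_natl.
by rewrite mulKf // pnatr_eq0 -lt0n.
Qed.

Lemma expect_gt0 f : (forall x, 0 < f x) -> 0 < expect f.
Proof.
move=> f0; have /card_gt0P[x _] := S_gt0.
have u0 : 0 < n^-1 by rewrite invr_gt0 ltr0n.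
rewrite /expect /unif (bigD1 x) //= ltr_pwDl ?mulr_gt0 // sumr_ge0 // => y _.
by rewrite mulr_ge0 // ltW.
Qed.

Lemma expect_sqr_eq0 f : expect (fun x => f x ^+ 2) = 0 -> forall x, f x = 0.
Proof.
move=> /eqP; rewrite /expect psumr_eq0 => [|x _]; last first.
  by rewrite mulr_ge0 ?sqr_ge0 // /unif invr_ge0.
move=> /allP h x; have := h x (mem_index_enum x).
by rewrite mulf_eq0 invr_eq0 pnatr_eq0 -leqn0 leqNgt S_gt0 sqrf_eq0 => /eqP.
Qed.

Definition centered (B : {set S}) (x : S) : R :=
  (x \in B)%:R - expect (fun y => (y \in B)%:R).

Lemma expect_centered B : expect (centered B) = 0.
Proof.
pose b : R := expect (fun y => (y \in B)%:R).
by rewrite (expectD (fun x => (x \in B)%:R) (fun=> - b)) expect_cst subrr.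
Qed.

Lemma norm_centered_le1 B x : `|centered B x| <= 1.
Proof.
have b0 : 0 <= expect (fun y => (y \in B)%:R : R).
  by apply: expect_ge0 => y; case: (_ \in _).
have b1 : expect (fun y => (y \in B)%:R : R) <= 1.
  by rewrite -[leRHS]expect_cst le_expect // => y; case: (_ \in _).
rewrite ler_norml /centered; move: b0 b1; set b := expect _ => b0 b1.
by case: (_ \in _) => /=; lra.
Qed.

Lemma centered_le1 B x : centered B x <= 1.
Proof. exact: le_trans (ler_norm _) (norm_centered_le1 B x). Qed.

Lemma centered_sqr_le1 B x : centered B x ^+ 2 <= 1.
Proof. by rewrite -real_normK ?num_real // exprn_ile1 // norm_centered_le1. Qed.

Lemma expect_centered_sqr_le1 B : expect (fun x => centered B x ^+ 2) <= 1.
Proof.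
by rewrite -[leRHS]expect_cst le_expect // => x; exact: centered_sqr_le1.
Qed.

End Expect.

Lemma tv_dist_le (R : realType) (S : finType) (mu nu : S -> R) (a : R) :
  \sum_x mu x = \sum_x nu x ->
  (forall B : {set S}, \sum_(x in B) (mu x - nu x) <= a) -> tv_dist mu nu <= a.
Proof.
move=> s /(_ [set x | 0 < mu x - nu x]); apply: le_trans.
have -> : \sum_(x in [set x | 0 < mu x - nu x]) (mu x - nu x) =
  2^-1 * \sum_x (`|mu x - nu x| + (mu x - nu x)).
  rewrite big_mkcond mulr_sumr; apply: eq_bigr => x _; rewrite inE.
  by case: ltrP => h; rewrite ?(ltr0_norm h) ?(gtr0_norm h) ?(ler0_norm h); lra.
by rewrite /tv_dist big_split /= sumrB s subrr addr0.
Qed.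

(** The overlap of the two laws, the pointwise minimum of their densities, has
    mass at least 1/2.  Integrated against it, the squared difference of the
    means is at most twice the sum of the squared deviations of [F] from each
    of them, so two laws that are close in total variation cannot have means
    many standard deviations apart. *)
Lemma overlap_mean (R : realType) (S : finType) (p1 p2 F : S -> R)
    (m1 m2 V1 V2 : R) :
  (forall x, 0 <= p1 x) -> (forall x, 0 <= p2 x) ->
  \sum_x p1 x = 1 -> \sum_x p2 x = 1 -> \sum_x `|p1 x - p2 x| <= 1 ->
  \sum_x p1 x * (F x - m1) ^+ 2 <= V1 -> \sum_x p2 x * (F x - m2) ^+ 2 <= V2 ->
  (m1 - m2) ^+ 2 <= 4 * (V1 + V2).
Proof.
move=> p10 p20 s1 s2 tv v1 v2.
pose o x := (p1 x + p2 x - `|p1 x - p2 x|) / 2.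
have o_half : 2^-1 <= \sum_x o x.
  rewrite -mulr_suml sumrB big_split /= s1 s2; lra.
have o_le x : o x * (m1 - m2) ^+ 2 <=
    2 * (p1 x * (F x - m1) ^+ 2) + 2 * (p2 x * (F x - m2) ^+ 2).
  have := p10 x; have := p20 x; rewrite /o.
  have sq0 := sqr_ge0 (F x - m1); have sq1 := sqr_ge0 (F x - m2).
  have sq2 := sqr_ge0 (F x - m1 + (F x - m2)).
  have e : (m1 - m2) ^+ 2 = 2 * (F x - m1) ^+ 2 + 2 * (F x - m2) ^+ 2 -
     (F x - m1 + (F x - m2)) ^+ 2 by ring.
  case: (lerP 0 (p1 x - p2 x)) => h; rewrite ?(ger0_norm h) ?(ltr0_norm h) => h1 h2.
    have -> : (p1 x + p2 x - (p1 x - p2 x)) / 2 = p2 x by lra.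
    have h3 : p2 x * (m1 - m2) ^+ 2 <= p2 x * (2 * (F x - m1) ^+ 2 + 2 * (F x - m2) ^+ 2).
      by rewrite ler_wpM2l //; lra.
    have h4 : p2 x * (F x - m1) ^+ 2 <= p1 x * (F x - m1) ^+ 2.
      by rewrite ler_wpM2r //; lra.
    by lra.
  have -> : (p1 x + p2 x - - (p1 x - p2 x)) / 2 = p1 x by lra.
  have h3 : p1 x * (m1 - m2) ^+ 2 <= p1 x * (2 * (F x - m1) ^+ 2 + 2 * (F x - m2) ^+ 2).
    by rewrite ler_wpM2l //; lra.
  have h4 : p1 x * (F x - m2) ^+ 2 <= p2 x * (F x - m2) ^+ 2.
    by rewrite ler_wpM2r //; lra.
  by lra.
have : \sum_x o x * (m1 - m2) ^+ 2 <= \sum_x (2 * (p1 x * (F x - m1) ^+ 2) +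
    2 * (p2 x * (F x - m2) ^+ 2)) by rewrite ler_sum.
rewrite -mulr_suml big_split /= -!mulr_sumr => le.
have : 2^-1 * (m1 - m2) ^+ 2 <= (\sum_x o x) * (m1 - m2) ^+ 2.
  by rewrite ler_wpM2r ?sqr_ge0.
lra.
Qed.

(** Discarding a point where [phi] is largest does not increase the average of
    [phi]. *)
Lemma select_subset (R : realType) (T : finType) (phi : T -> R) k (X : {set T}) :
  (k <= #|X|)%N -> exists A : {set T}, [/\ A \subset X, #|A| = k &
    #|X|%:R * \sum_(a in A) phi a <= k%:R * \sum_(a in X) phi a].
Proof.
move=> kX; have [n] := ubnP (#|X| - k); elim: n X kX => // n IH X kX Xn.
case: (posnP k) => [k0|k0].
  exists finset.set0; rewrite finset.sub0set cards0 k0 big_set0 mulr0 mul0r; split => //.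
move: kX; rewrite leq_eqVlt => /predU1P[kX|kX].
  by exists X; rewrite -kX.
have /card_gt0P[x0 x0X] : (0 < #|X|)%N by apply: leq_ltn_trans kX.
have [x xX xmax] := @arg_maxP _ _ _ x0 [in X] phi x0X.
have cX : #|X| = #|X :\ x|.+1 by rewrite (cardsD1 x) xX.
have kX' : (k <= #|X :\ x|)%N by rewrite -ltnS -cX.
have lt : (#|X :\ x| - k < n)%N by move: Xn; rewrite cX subSn.
have [A [AX cA le]] := IH _ kX' lt.
exists A; split => //; first exact: fintype.subset_trans AX (subD1set _ _).
have X'0 : 0 < #|X :\ x|%:R :> R by rewrite ltr0n (leq_trans k0).
have avg : \sum_(a in X) phi a <= #|X|%:R * phi x.
  by rewrite mulr_natl -sumr_const ler_sum // => a aX; exact: xmax.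
have sX : \sum_(a in X) phi a = phi x + \sum_(a in X :\ x) phi a by exact: big_setD1.
rewrite -(ler_pM2l X'0).
have : #|X|%:R * (#|X :\ x|%:R * \sum_(a in A) phi a) <=
   #|X|%:R * (k%:R * \sum_(a in X :\ x) phi a) by rewrite ler_wpM2l.
have : #|X|%:R * \sum_(a in X :\ x) phi a <= #|X :\ x|%:R * \sum_(a in X) phi a.
  have eX : #|X|%:R = #|X :\ x|%:R + 1 :> R by rewrite cX natr1.
  rewrite [in leRHS]sX; move: avg; rewrite eX sX; lra.
move=> /(ler_wpM2l (ler0n R k)); lra.
Qed.

Lemma exists_superset (T : finType) k (D : {set T}) : (#|D| <= k)%N ->
  (k <= #|T|)%N -> exists A : {set T}, D \subset A /\ #|A| = k.
Proof.
move=> Dk kT; have [n] := ubnP (k - #|D|); elim: n D Dk => // n IH D Dk.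
rewrite ltnS => kn; move: Dk; rewrite leq_eqVlt => /predU1P[Dk|Dk]; first by exists D.
have /card_gt0P[x xD] : (0 < #|~: D|)%N.
  by rewrite -(ltn_add2l #|D|) cardsC addn0 (leq_trans Dk).
have cD : #|x |: D| = #|D|.+1 by rewrite cardsU1 -finset.in_setC xD.
have [||A [sA cA]] := IH (x |: D); rewrite ?cD //.
  by rewrite -subSn // subSS.
by exists A; split => //; apply: fintype.subset_trans sA; exact: finset.subsetUr.
Qed.

(** * Differentiation of finite sums of exponentials *)

Lemma is_derive_fsum (R : realType) (I : finType) (h : I -> R -> R) (dh : I -> R)
    (x : R) :
  (forall i, is_derive x 1 (h i) (dh i)) ->
  is_derive x 1 (fun s => \sum_i h i s) (\sum_i dh i).
Proof.
move=> hd; have -> : (fun s => \sum_i h i s) = \sum_i h i.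
  by apply/funext => s; rewrite fct_sumE.
by elim/big_ind2 : _ => // [|] *; [exact: is_derive_cst|exact: is_deriveD].
Qed.

Lemma is_derive_expRZ (R : realType) (a c x : R) :
  is_derive x 1 (fun s : R => expR (s * a) * c) (expR (x * a) * (a * c)).
Proof.
have e : is_derive x 1 (fun s : R => s * a) a.
  rewrite (_ : (fun s => s * a) = a \*: id).
    by apply: is_derive_eq; rewrite /GRing.scale /= mulr1.
  by apply/funext => s; rewrite /= mulrC.
have h : is_derive x 1 (expR \o (fun s : R => s * a)) (expR (x * a) * a).
  exact: is_derive1_comp.
rewrite (_ : (fun s => _) = c \*: (expR \o (fun s : R => s * a))).
  apply: is_derive_eq; rewrite /GRing.scale /=; ring.
by apply/funext => s; rewrite /= mulrC.
Qed.

Lemma le_of_derive_ge0 (R : realType) (f df : R -> R) (a b : R) :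
  (forall x : R, is_derive x 1 f (df x)) -> (forall x, a <= x <= b -> 0 <= df x) ->
  a <= b -> f a <= f b.
Proof.
move=> fd df0 ab; apply: (@ger0_derive1_ndecr _ f a b) => //.
- move=> x; rewrite in_itv /= => /andP[ax xb].
  by rewrite derive1E derive_val df0 ?ltW.
- apply: derivable_within_continuous => x _; apply: ex_derive; exact: fd.
Qed.

(** * Eigenvector expansion of a reversible semigroup *)

Section Frame.
Import complex.

(** A real symmetric matrix is diagonalised by a complex unitary matrix, with
    real eigenvalues.  The real and imaginary parts of its rows are again
    eigenvectors; these twice as many real vectors are no longer orthonormal,
    but they still resolve the identity (a Parseval frame), which is all that
    an expansion in eigenvectors needs. *)
Lemma symmetric_eigenframe (R : realType) n (M : 'M[R]_n) : M^T = M ->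
  exists (I : finType) (w : I -> 'I_n -> R) (D : I -> R),
    (forall x y, \sum_i w i x * w i y = (x == y)%:R) /\
    (forall i x, \sum_y M x y * w i y = D i * w i x).
Proof.
move=> symM.
pose f := real_complex R.
pose A : 'M[R[i]]_n := map_mx f M.
have Areal : A \is a mxOver Num.real.
  by apply/mxOverP => i j; rewrite mxE; apply/complex_realP; exists (M i j).
have Asym : A \is symmetricmx.
  apply/is_hermitianmxP; rewrite expr0 scale1r map_mx_id //.
  by rewrite /A -{1}symM; apply/matrixP => i j; rewrite !mxE.
have Aherm := realsym_hermsym Asym Areal.
have /orthomx_spectralP Aeq := hermitian_normalmx Aherm.
have Dreal := hermitian_spectral_diag_real Aherm.
set P := spectralmx A in Aeq; set sp := spectral_diag A in Aeq Dreal.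
have Puni : P \is unitarymx := spectral_unitarymx A.
have PA : P *m A = diag_mx sp *m P.
  by rewrite Aeq !mulmxA mulmxV ?spectral_unit // mul1mx.
have PP : (P ^t*)%sesqui *m P = 1%:M.
  by rewrite -invmx_unitary // mulVmx // spectral_unit.
exists ('I_n * bool)%type.
exists (fun ib x => if ib.2 then Re (P ib.1 x) else Im (P ib.1 x)).
exists (fun ib => Re (sp 0 ib.1)).
split=> [x y|[i b] x /=].
- have /matrixP /(_ x y) := PP.
  rewrite !mxE => /(congr1 (@Re R)); rewrite raddf_sum.
  rewrite (_ : Re ((x == y)%:R) = (x == y)%:R); last by case: (x == y).
  move=> <-.
  rewrite -(pair_bigA _ (fun i (b : bool) =>
    (if b then Re (P i x) else Im (P i x)) *
    (if b then Re (P i y) else Im (P i y)))) /=.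
  apply: eq_bigr => i _; rewrite big_bool /= !mxE.
  case: (P i x) => a b; case: (P i y) => c d. 
  by rewrite /= mulNr opprK.
- have /matrixP /(_ i x) := PA; rewrite !mxE.
  rewrite [RHS](bigD1 i) //= [X in _ = _ + X]big1 ?addr0; last first.
    by move=> j ji; rewrite !mxE eq_sym (negbTE ji) mulr0n mul0r.
  rewrite mxE eqxx mulr1n => E.
  have Di : (Re (sp 0 i))%:C%C = sp 0 i by apply/RRe_real/mxOverP.
  rewrite -Di in E.
  have symMxy y : M x y = M y x by rewrite -{1}symM mxE.
  case: b.
    move: E => /(congr1 (@Re R)); rewrite raddf_sum /=.
    case: (P i x) => a b; rewrite /= mul0r subr0 => <-.
    apply: eq_bigr => y _; rewrite mxE symMxy /f; case: (P i y) => c d.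
    by rewrite /= mulr0 subr0 mulrC.
  move: E => /(congr1 (@Im R)); rewrite raddf_sum /=.
  case: (P i x) => a b; rewrite /= mul0r addr0 => <-.
  apply: eq_bigr => y _; rewrite mxE symMxy /f; case: (P i y) => c d.
  by rewrite /= mulr0 add0r mulrC.
Qed.
End Frame.

Section ExponentialSeries.
Local Open Scope classical_set_scope.

Lemma exp_series_frame (R : realType) n (N : 'M[R]_n) (I : finType)
    (w : I -> 'I_n -> R) (D : I -> R) (t : R) x y :
  (forall x y, \sum_i w i x * w i y = (x == y)%:R) ->
  (forall i x, \sum_y N x y * w i y = D i * w i x) ->
  series (fun j => exp_coeff t j * (N ^+ j) x y) @ \oo -->
    \sum_i expR (t * D i) * (w i x * w i y).
Proof.
move=> par eig.
have pow j : forall a b, (N ^+ j) a b = \sum_i D i ^+ j * (w i a * w i b).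
  elim: j => [|j IH] a b.
    rewrite expr0 mxE -par; apply: eq_bigr => i _; by rewrite expr0 mul1r.
  rewrite exprS mxE; under eq_bigr do rewrite IH mulr_sumr.
  rewrite exchange_big; apply: eq_bigr => i _ /=.
  rewrite exprS -mulrA mulrCA (mulrA (D i)) -eig mulr_suml mulr_sumr.
  by apply: eq_bigr => c _; ring.
have -> : series (fun j => exp_coeff t j * (N ^+ j) x y) =
    (fun m => \sum_i series (exp_coeff (t * D i)) m * (w i x * w i y)).
  apply/funext => m; rewrite /series /=.
  under eq_bigr do rewrite pow mulr_sumr.
  rewrite exchange_big; apply: eq_bigr => i _ /=; rewrite mulr_suml.
  by apply: eq_bigr => j _; rewrite /exp_coeff /= exprMn; ring.
apply: cvg_big => [|i _]; first exact: add_continuous.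
  by apply: cvgMl; exact: is_cvg_series_exp_coeff.
Qed.

End ExponentialSeries.

Section Semigroup.
Variables (R : realType) (S : finType) (q : S -> S -> R).
Implicit Types (f g h : S -> R) (s t a : R).

Definition gen f (x : S) : R := \sum_y q x y * (f y - f x).
Definition semigroup t f (x : S) : R := \sum_y transition q t x y * f y.

Lemma generator_sum f x : \sum_y generator q x y * f y = gen f x.
Proof.
rewrite /gen (bigD1 x) //= [RHS](bigD1 x) //= subrr mulr0 add0r.
rewrite /generator eqxx mulNr mulr_suml -sumrN -big_split /=.
apply: eq_bigr => y yx; rewrite eq_sym (negbTE yx); ring.
Qed.

Lemma generator_mx_sum f x :
  \sum_j generator_mx q (enum_rank x) j * f (enum_val j) = gen f x.
Proof.
rewrite -generator_sum [RHS](reindex (@enum_val S predT)) /=; last first.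
  by apply: onW_bij; exact: enum_val_bij.
by apply: eq_bigr => j _; rewrite mxE enum_rankK.
Qed.

Lemma eq_gen f g : f =1 g -> gen f =1 gen g.
Proof. by move=> fg x; apply: eq_bigr => y _; rewrite !fg. Qed.

Lemma gen_sum (I : finType) (c : I -> R) (u : I -> S -> R) x :
  gen (fun y => \sum_i c i * u i y) x = \sum_i c i * gen (u i) x.
Proof.
rewrite /gen; under [RHS]eq_bigr do rewrite mulr_sumr.
rewrite [RHS]exchange_big; apply: eq_bigr => y _ /=.
rewrite -sumrB mulr_sumr; apply: eq_bigr => i _; ring.
Qed.

Lemma eq_semigroup t f g : f =1 g -> semigroup t f =1 semigroup t g.
Proof. by move=> fg x; apply: eq_bigr => y _; rewrite !fg. Qed.

Lemma semigroupD t f g x :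
  semigroup t (fun y => f y + g y) x = semigroup t f x + semigroup t g x.
Proof. by rewrite -big_split; apply: eq_bigr => y _ /=; rewrite mulrDr. Qed.

Lemma semigroupZ t a f x :
  semigroup t (fun y => a * f y) x = a * semigroup t f x.
Proof. by rewrite mulr_sumr; apply: eq_bigr => y _ /=; rewrite mulrCA. Qed.

Lemma semigroup_sum (I : finType) (P : pred I) t (c : I -> R) (u : I -> S -> R) x :
  semigroup t (fun y => \sum_(i | P i) c i * u i y) x =
  \sum_(i | P i) c i * semigroup t (u i) x.
Proof.
rewrite /semigroup; under [RHS]eq_bigr do rewrite mulr_sumr.
rewrite [RHS]exchange_big; apply: eq_bigr => y _ /=.
rewrite mulr_sumr; apply: eq_bigr => i _; ring.
Qed.

Hypothesis qsym : forall x y, q x y = q y x.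

Lemma gen_self_adjoint f g : \sum_x gen f x * g x = \sum_x f x * gen g x.
Proof.
rewrite /gen; under eq_bigr do rewrite mulr_suml.
under [RHS]eq_bigr do rewrite mulr_sumr.
apply/eqP; rewrite -subr_eq0 -sumrB; apply/eqP.
under eq_bigr do rewrite -sumrB.
have -> : \sum_x \sum_y (q x y * (f y - f x) * g x - f x * (q x y * (g y - g x))) =
  \sum_x \sum_y (q x y * f y * g x) - \sum_x \sum_y (q x y * f x * g y).
  rewrite -sumrB; apply: eq_bigr => x _; rewrite -sumrB; apply: eq_bigr => y _.
  ring.
rewrite exchange_big /= -sumrB big1 // => x _; rewrite -sumrB big1 // => y _.
by rewrite (qsym y x) subrr.
Qed.

(** The eigenvector expansion of the transition probabilities turns the
    semigroup into a finite combination of exponentials; the semigroup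
    property, the derivative in time and the decay of the variance are read
    off from it. *)
Lemma chain_frame : exists (I : finType) (w : I -> S -> R) (D : I -> R),
  [/\ forall x y, \sum_i w i x * w i y = (x == y)%:R,
      forall i x, gen (w i) x = D i * w i x &
      forall t x y, transition q t x y =
        \sum_i expR (t * D i) * (w i x * w i y)].
Proof.
have symM : (generator_mx q)^T = generator_mx q.
  apply/matrixP => i j; rewrite !mxE /generator eq_sym.
  by case: eqP => [->|_] //.
have [I [w [D [par eig]]]] := symmetric_eigenframe symM.
exists I, (fun i x => w i (enum_rank x)), D; split.
- by move=> x y; rewrite par (inj_eq enum_rank_inj).
- move=> i x; rewrite -eig -generator_mx_sum.
  by apply: eq_bigr => j _; rewrite enum_valK.
- by move=> t x y; apply: cvg_lim => //; exact: exp_series_frame.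
Qed.

Lemma frame_expansion (I : finType) (w : I -> S -> R) f x :
  (forall x y, \sum_i w i x * w i y = (x == y)%:R) ->
  f x = \sum_i (\sum_y w i y * f y) * w i x.
Proof.
move=> par; under eq_bigr do rewrite mulr_suml.
rewrite exchange_big /= (bigD1 x) //= [X in _ + X]big1 ?addr0 => [|y yx].
  transitivity (f x * \sum_i w i x * w i x); first by rewrite par eqxx mulr1.
  by rewrite mulr_sumr; apply: eq_bigr => i _; ring.
transitivity (f y * \sum_i w i x * w i y).
  by rewrite mulr_sumr; apply: eq_bigr => i _; ring.
by rewrite par eq_sym (negbTE yx) mulr0.
Qed.

Lemma semigroup_frame (I : finType) (w : I -> S -> R) (D : I -> R) t f x :
  (forall t x y, transition q t x y = \sum_i expR (t * D i) * (w i x * w i y)) ->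
  semigroup t f x = \sum_i expR (t * D i) * (\sum_y w i y * f y) * w i x.
Proof.
move=> tr; rewrite /semigroup; under eq_bigr do rewrite tr mulr_suml.
rewrite exchange_big; apply: eq_bigr => i _ /=.
rewrite -mulrA mulr_suml mulr_sumr; apply: eq_bigr => y _; ring.
Qed.

Lemma transition_sym t x y : transition q t x y = transition q t y x.
Proof.
have [I [w [D [_ _ tr]]]] := chain_frame.
by rewrite !tr; apply: eq_bigr => i _; rewrite (mulrC (w i x)).
Qed.

Lemma semigroup_self_adjoint t f g :
  \sum_x semigroup t f x * g x = \sum_x f x * semigroup t g x.
Proof.
rewrite /semigroup; under eq_bigr do rewrite mulr_suml.
rewrite exchange_big; apply: eq_bigr => y _ /=.
rewrite mulr_sumr; apply: eq_bigr => x _; rewrite (transition_sym t x y); ring.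
Qed.

(** Vectors of the frame with different eigenvalues are orthogonal, even though
    the frame is not orthonormal: only the vectors sharing the eigenvalue [a]
    contribute to the expansion of [f]. *)
Lemma semigroup_eigen t a f :
  (forall x, gen f x = a * f x) -> forall x, semigroup t f x = expR (t * a) * f x.
Proof.
move=> fa x; have [I [w [D [par eig tr]]]] := chain_frame.
rewrite (semigroup_frame t f x tr) [f x in RHS](frame_expansion f x par) mulr_sumr.
apply: eq_bigr => i _; rewrite -mulrA !(mulrA (expR _)); congr (_ * _).
have : D i * (\sum_y w i y * f y) = a * (\sum_y w i y * f y).
  have := gen_self_adjoint (w i) f.
  under eq_bigr do rewrite eig -mulrA.
  under [X in _ = X -> _]eq_bigr do rewrite fa mulrCA.
  by rewrite -!mulr_sumr.
move/eqP; rewrite -subr_eq0 -mulrBl mulf_eq0 => /orP[|/eqP ->].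
  by rewrite subr_eq0 => /eqP ->.
by rewrite !mulr0.
Qed.

Lemma semigroup_cst t a x : semigroup t (fun=> a) x = a.
Proof.
rewrite (@semigroup_eigen t 0) ?mulr0 ?expR0 ?mul1r // => y.
by rewrite mul0r /gen big1 // => z _; rewrite subrr mulr0.
Qed.

Lemma transition_sum1 t x : \sum_y transition q t x y = 1.
Proof.
rewrite -[RHS](semigroup_cst t 1 x).
by apply: eq_bigr => y _; rewrite mulr1.
Qed.

Lemma semigroup0 f x : semigroup 0 f x = f x.
Proof.
have [I [w [D [par eig tr]]]] := chain_frame.
rewrite (semigroup_frame 0 f x tr) [RHS](frame_expansion f x par).
by apply: eq_bigr => i _; rewrite mul0r expR0 mul1r.
Qed.

Lemma semigroup_add s t f x :
  semigroup (s + t) f x = semigroup s (semigroup t f) x.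
Proof.
have [I [w [D [par eig tr]]]] := chain_frame.
rewrite (eq_semigroup _ (fun y => semigroup_frame t f y tr)) semigroup_sum.
rewrite (semigroup_frame _ f x tr); apply: eq_bigr => i _.
by rewrite (@semigroup_eigen s (D i)) // mulrDl expRD; ring.
Qed.

Lemma semigroup_gen t f x : semigroup t (gen f) x = gen (semigroup t f) x.
Proof.
have [I [w [D [par eig tr]]]] := chain_frame.
rewrite (semigroup_frame t _ x tr) (eq_gen (fun y => semigroup_frame t f y tr)).
rewrite gen_sum; apply: eq_bigr => i _; rewrite eig -!mulrA; congr (_ * _).
rewrite -gen_self_adjoint mulr_suml mulr_suml.
by apply: eq_bigr => y _; rewrite eig; ring.
Qed.

Lemma expect_semigroup t f : expect (semigroup t f) = expect f.
Proof.
rewrite /expect -!mulr_sumr; congr (_ * _).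
have := semigroup_self_adjoint t f (fun=> 1).
under eq_bigr do rewrite mulr1.
by under [X in _ = X -> _]eq_bigr do rewrite semigroup_cst mulr1.
Qed.

End Semigroup.

Section Positivity.
Variables (R : realType) (S : finType) (q : S -> S -> R).
Hypothesis qsym : forall x y, q x y = q y x.
Hypothesis q_ge0 : forall x y, 0 <= q x y.

(** Adding a large multiple of the identity to the generator only multiplies
    its exponential by a positive scalar, and makes all the entries of the
    matrix, hence all the terms of the series, nonnegative. *)
Lemma transition_ge0 (t : R) x y : 0 <= t -> 0 <= transition q t x y.
Proof.
move=> t0; have [I [w [D [par eig tr]]]] := chain_frame qsym.
pose M := generator_mx q; pose L : R := \sum_x \sum_z q x z.
have L0 i : generator q i i + L >= 0.
  rewrite /generator eqxx /L addrC subr_ge0 [leRHS](bigD1 i) //=.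
  rewrite [X in _ <= X + _](bigD1 i) //= addrAC [leRHS]addrC lerDl addr_ge0 //.
  by rewrite sumr_ge0 // => j _; exact: sumr_ge0.
have N_ge0 j : forall a b, 0 <= ((M + L%:M) ^+ j) a b.
  elim: j => [|j IH] a b; first by rewrite expr0 mxE; case: (_ == _).
  rewrite exprS mxE sumr_ge0 // => c _; rewrite mulr_ge0 //.
  rewrite !mxE; case: (eqVneq a c) => [->|ac]; first by rewrite mulr1n.
  by rewrite mulr0n addr0 /generator (inj_eq enum_val_inj) (negbTE ac).
pose w' i (a : 'I_#|S|) := w i (enum_val a).
have := @exp_series_frame R _ (M + L%:M) I w' (fun i => D i + L) t
          (enum_rank x) (enum_rank y).
have par' a b : \sum_i w' i a * w' i b = (a == b)%:R.
  by rewrite par (inj_eq enum_val_inj).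
have eig' i a : \sum_b (M + L%:M) a b * w' i b = (D i + L) * w' i a.
  under eq_bigr do rewrite mxE mulrDl.
  rewrite big_split /= mulrDl -eig -generator_mx_sum enum_valK; congr (_ + _).
  rewrite (bigD1 a) //= big1 ?addr0 => [|b ba]; first by rewrite mxE eqxx mulr1n.
  by rewrite mxE eq_sym (negbTE ba) mulr0n mul0r.
move=> /(_ par' eig') cv.
have lim0 : 0 <= \sum_i expR (t * (D i + L)) *
    (w' i (enum_rank x) * w' i (enum_rank y)).
  rewrite -(cvg_lim _ cv) //; apply: limr_ge; first by apply/cvg_ex; eexists; exact: cv.
  apply: nearW => m; rewrite sumr_ge0 // => j _.
  by rewrite mulr_ge0 // exp_coeff_ge0.
rewrite tr -(pmulr_rge0 _ (expR_gt0 (t * L))) mulr_sumr.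
move: lim0; congr (_ <= _); apply: eq_bigr => i _.
by rewrite /w' !enum_rankK mulrDr expRD; ring.
Qed.

Lemma is_derive_semigroup (t : R) (f : S -> R) (x : S) :
  is_derive t 1 (fun s => semigroup q s f x) (semigroup q t (gen q f) x).
Proof.
have [I [w [D [par eig tr]]]] := chain_frame qsym.
have -> : (fun s => semigroup q s f x) =
    (fun s => \sum_i expR (s * D i) * ((\sum_y w i y * f y) * w i x)).
  apply/funext => s; rewrite (semigroup_frame s f x tr).
  by apply: eq_bigr => i _; rewrite mulrA.
rewrite semigroup_gen // (eq_gen q (fun y => semigroup_frame t f y tr)) gen_sum.
have := is_derive_fsum (fun i => is_derive_expRZ (D i)
  ((\sum_y w i y * f y) * w i x) t).
congr (is_derive _ _ _ _); apply: eq_bigr => i _; rewrite eig; ring.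
Qed.

Lemma le_semigroup (t : R) f g x : 0 <= t -> (forall y, f y <= g y) ->
  semigroup q t f x <= semigroup q t g x.
Proof.
by move=> t0 fg; rewrite ler_sum // => y _; rewrite ler_wpM2l // transition_ge0.
Qed.

Lemma semigroup_indicator (t : R) (A : {set S}) x :
  semigroup q t (fun y => (y \in A)%:R) x = \sum_(y in A) transition q t x y.
Proof.
rewrite /semigroup [RHS]big_mkcond; apply: eq_bigr => y _.
by case: (_ \in _); rewrite ?mulr1 ?mulr0.
Qed.

Lemma semigroup_centered (t : R) (B : {set S}) x :
  semigroup q t (centered R B) x =
  \sum_(y in B) (transition q t x y - #|S|%:R^-1).
Proof.
pose b : R := expect (fun y => (y \in B)%:R).
rewrite (semigroupD q t (fun y => (y \in B)%:R) (fun=> - b)) (semigroup_cst qsym).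
rewrite semigroup_indicator sumrB; congr (_ - _).
rewrite /b /expect /unif [RHS]big_mkcond; apply: eq_bigr => y _ /=.
by case: (_ \in _); rewrite ?mulr1 ?mulr0.
Qed.

Lemma tv_dist_transition_le (t a : R) x : (0 < #|S|)%N ->
  (forall B : {set S}, semigroup q t (centered R B) x <= a) ->
  tv_dist (transition q t x) (@unif R S) <= a.
Proof.
move=> S0 h; apply: tv_dist_le => [|B].
  rewrite transition_sum1 // /unif sumr_const -[_ *+ _]mulr_natl divff //.
  by rewrite pnatr_eq0 -lt0n.
by rewrite -semigroup_centered.
Qed.

End Positivity.

(** If the observable moves with time, its own time derivative adds to the
    action of the generator. *)
Lemma is_derive_semigroup_path (R : realType) (S : finType) (q : S -> S -> R)
    (Psi : R -> S -> R) (dPsi : S -> R) (s : R) (x : S) :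
  (forall x y, q x y = q y x) ->
  (forall y, is_derive s 1 (Psi^~ y) (dPsi y)) ->
  is_derive s 1 (fun s => semigroup q s (Psi s) x)
    (semigroup q s (fun y => gen q (Psi s) y + dPsi y) x).
Proof.
move=> qsym dP.
pose dl (y z : S) : R := (z == y)%:R.
have trE u y : transition q u x y = semigroup q u (dl y) x.
  rewrite /semigroup (bigD1 y) //= /dl eqxx mulr1 big1 ?addr0 // => z zy.
  by rewrite (negbTE zy) mulr0.
have dtr y : is_derive s 1 (fun u => transition q u x y)
    (semigroup q s (gen q (dl y)) x).
  rewrite (_ : (fun u => _) = (fun u => semigroup q u (dl y) x)).
    exact: is_derive_semigroup.
  by apply/funext => u; exact: trE.
have := is_derive_fsum (fun y => is_deriveM (dtr y) (dP y)).
congr (is_derive _ _ _ _).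
rewrite big_split /= semigroupD addrC; congr (_ + _).
rewrite -(semigroup_sum q xpredT s (Psi s) (fun y => gen q (dl y))).
apply: eq_semigroup => z; rewrite -gen_sum; apply: eq_gen => u.
rewrite (bigD1 u) //= /dl eqxx mulr1 big1 ?addr0 // => y yu.
by rewrite eq_sym (negbTE yu) mulr0.
Qed.

Lemma gen_sqr (R : realType) (S : finType) (q : S -> S -> R) (f : S -> R) x :
  gen q (fun y => f y ^+ 2) x - 2 * f x * gen q f x =
  \sum_y q x y * (f y - f x) ^+ 2.
Proof.
rewrite /gen mulr_sumr -sumrB; apply: eq_bigr => y _; ring.
Qed.

(** * Spectral gap *)

Section Gap.
Variables (R : realType) (S : finType) (q : S -> S -> R).
Implicit Types (f g h : S -> R).
Hypothesis qsym : forall x y, q x y = q y x.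

Lemma dirichlet_rate f :
  dirichlet q f = 2^-1 * (#|S|%:R^-1 * \sum_x \sum_y q x y * (f x - f y) ^+ 2).
Proof.
rewrite /dirichlet; congr (_ * _); rewrite mulr_sumr; apply: eq_bigr => x _.
rewrite mulr_sumr; apply: eq_bigr => y _; rewrite /unif /generator.
case: eqP => [->|_]; first by rewrite subrr expr0n /= !mulr0.
by rewrite -mulrA.
Qed.

Lemma dirichletE f : dirichlet q f = - expect (fun x => f x * gen q f x).
Proof.
rewrite dirichlet_rate /expect /unif -mulr_sumr -mulrN mulrCA; congr (_ * _).
have -> : \sum_x \sum_y q x y * (f x - f y) ^+ 2 =
  \sum_x \sum_y (q x y * (f x ^+2 - f x * f y)) +
  \sum_x \sum_y (q x y * (f y ^+2 - f x * f y)).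
  rewrite -big_split; apply: eq_bigr => x _ /=.
  by rewrite -big_split; apply: eq_bigr => y _ /=; ring.
rewrite [X in _ + X]exchange_big /=.
have -> : \sum_j \sum_i q i j * (f j ^+ 2 - f i * f j) =
   \sum_x \sum_y (q x y * (f x ^+2 - f x * f y)).
  by apply: eq_bigr => x _; apply: eq_bigr => y _; rewrite qsym (mulrC (f y)).
set s := \sum_x _; have -> : 2^-1 * (s + s) = s by lra.
rewrite -sumrN; apply: eq_bigr => x _; rewrite /gen mulr_sumr -sumrN.
by apply: eq_bigr => y _; ring.
Qed.

Hypothesis q_ge0 : forall x y, 0 <= q x y.

Lemma dirichlet_ge0 f : 0 <= dirichlet q f.
Proof.
rewrite dirichlet_rate !mulr_ge0 // ?invr_ge0 // sumr_ge0 // => x _.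
by rewrite sumr_ge0 // => y _; rewrite mulr_ge0 // sqr_ge0.
Qed.

Hypothesis cardS : (1 < #|S|)%N.

Let S_gt0 : (0 < #|S|)%N := ltnW cardS.

Let n_gt0 : 0 < #|S|%:R :> R.
Proof. by rewrite ltr0n (leq_trans _ cardS). Qed.

Hypothesis irr : forall f,
  (forall x y, q x y * (f x - f y) ^+ 2 = 0) -> forall x y, f x = f y.

Lemma dirichlet_eq0 f : dirichlet q f = 0 -> forall x y, f x = f y.
Proof.
have t0 x y : 0 <= q x y * (f x - f y) ^+ 2 by rewrite mulr_ge0 ?sqr_ge0.
move=> /eqP; rewrite dirichlet_rate mulf_eq0 invr_eq0 pnatr_eq0 /=.
rewrite mulf_eq0 invr_eq0 (negbTE (lt0r_neq0 n_gt0)) /=.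
rewrite psumr_eq0 => [|x _]; last exact: sumr_ge0.
move=> /allP h; apply: irr => x y.
have := h x (mem_index_enum x); rewrite psumr_eq0 //= => /allP /(_ y).
by rewrite mem_index_enum => /(_ isT) /eqP.
Qed.

Lemma expect_eigen f (a : R) : (forall x, gen q f x = a * f x) ->
  a * expect f = 0.
Proof.
move=> fa; have := gen_self_adjoint qsym f (fun=> 1).
rewrite [RHS]big1 => [|x _]; last first.
  by rewrite /gen big1 ?mulr0 // => y _; rewrite subrr mulr0.
move=> h; rewrite /expect /unif -mulr_sumr mulrCA mulr_sumr.
rewrite (_ : \sum_x a * f x = 0) ?mulr0 // -[RHS]h.
by apply: eq_bigr => x _; rewrite fa mulr1.
Qed.

Lemma dirichlet_eigen f (a : R) : (forall x, gen q f x = a * f x) ->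
  dirichlet q f = - a * expect (fun x => f x ^+ 2).
Proof.
move=> fa; rewrite dirichletE mulNr /expect mulr_sumr; congr (- _).
by apply: eq_bigr => x _; rewrite fa; ring.
Qed.

Lemma eigen_le0 f (a : R) x0 : (forall x, gen q f x = a * f x) -> f x0 != 0 ->
  a <= 0.
Proof.
move=> fa f0; have := dirichlet_ge0 f; rewrite (dirichlet_eigen fa).
rewrite pmulr_lge0 ?oppr_ge0 // lt_neqAle eq_sym.
rewrite expect_ge0 ?andbT => [|x]; last exact: sqr_ge0.
by apply: contra f0 => /eqP /(expect_sqr_eq0 S_gt0) ->.
Qed.

Lemma eigenvalue_gen (l : R) : reflect
  (exists2 f, (forall x, gen q f x = - l * f x) & exists x, f x != 0)
  (eigenvalue (- generator_mx q) l).
Proof.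
have symM i j : generator_mx q i j = generator_mx q j i.
  by rewrite !mxE /generator eq_sym; case: eqP => [->|].
apply: (iffP eigenvalueP) => [[v vM v0]|[f fl [x fx]]].
- exists (fun x => v 0 (enum_rank x)).
    move=> x; have /matrixP /(_ 0 (enum_rank x)) := vM; rewrite !mxE mulNr => <-.
    rewrite -generator_mx_sum -sumrN; apply: eq_bigr => j _.
    by rewrite symM !mxE enum_valK; ring.
  case/rV0Pn: v0 => i vi; exists (enum_val i); by rewrite enum_valK.
- exists (\row_i f (enum_val i)).
    apply/rowP => i; rewrite !mxE -(opprK (l * _)) -[- (l * _)]mulNr -fl.
    rewrite -generator_mx_sum -sumrN enum_valK; apply: eq_bigr => j _.
    by rewrite [in RHS]symM !mxE; ring.
  by apply/rV0Pn; exists (enum_rank x); rewrite mxE enum_rankK.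
Qed.

Lemma gap_le_eigen f (a : R) x0 : (forall x, gen q f x = a * f x) ->
  f x0 != 0 -> a = 0 \/ gap q <= - a.
Proof.
move=> fa f0; case: (eqVneq a 0) => [->|a0]; [by left|right].
apply: ge_inf; first by exists 0 => l [/ltW].
split; first by rewrite oppr_gt0 lt_neqAle a0 (eigen_le0 fa f0).
apply/eigenvalue_gen; exists f; last by exists x0.
by move=> x; rewrite opprK.
Qed.

(** An eigenvector with eigenvalue 0 is constant by irreducibility, hence
    orthogonal to [f]. *)
Lemma frame_coef_eq0_or_gap (I : finType) (w : I -> S -> R) (D : I -> R) f i :
  (forall i x, gen q (w i) x = D i * w i x) -> expect f = 0 ->
  \sum_y w i y * f y = 0 \/ gap q <= - D i.
Proof.
move=> eig f0; case: (pickP (fun x => w i x != 0)) => [x0 wx|w0]; last first.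
  by left; rewrite big1 // => y _; have /negbFE/eqP -> := w0 y; rewrite mul0r.
have [Di|] := gap_le_eigen (eig i) wx; last by right.
left; have wc : forall y, w i y = w i x0.
  move=> y; apply: dirichlet_eq0.
  by rewrite (@dirichlet_eigen _ (D i)) // Di oppr0 mul0r.
under eq_bigr do rewrite wc.
move: f0 => /eqP; rewrite /expect /unif -mulr_sumr mulf_eq0.
by rewrite invr_eq0 (negbTE (lt0r_neq0 n_gt0)) /= -mulr_sumr => /eqP ->; rewrite mulr0.
Qed.

(** The infimum defining [gap] is attained: it ranges over the finitely many
    nonzero eigenvalues carried by the frame, and there is one, since otherwise
    all the vectors of the frame would be constant and could not separate two
    states. *)
Lemma gap_eigenfunction : exists f,
  [/\ 0 < gap q, expect f = 0, expect (fun x => f x ^+ 2) = 1 &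
      forall x, gen q f x = - gap q * f x].
Proof.
have [I [w [D [par eig tr]]]] := chain_frame qsym.
pose P i := (D i != 0) && [exists x, w i x != 0].
have [i0 Pi0] : exists i, P i.
  apply/existsP; rewrite -[X in is_true X]negbK; apply/negP => /existsPn noP.
  have wc i x y : w i x = w i y.
    have := noP i; rewrite negb_and => /orP[|/existsPn w0].
      rewrite negbK => /eqP Di; apply: dirichlet_eq0.
      by rewrite (@dirichlet_eigen _ (D i)) // Di oppr0 mul0r.
    have /negPn/eqP -> := w0 x; have /negPn/eqP -> := w0 y; by [].
  have /card_gt1P[x [y [_ _ xy]]] := cardS.
  have := par x y; rewrite (negbTE xy) => e1; have := par x x; rewrite eqxx.
  under eq_bigr do rewrite {2}(wc _ x y).
  by rewrite e1 => /eqP; rewrite eq_sym oner_eq0.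
have [i1 Pi1 mini] := @arg_minP _ _ _ i0 P (fun i => - D i) Pi0.
have /andP[Di1 /existsP[x1 wx1]] := Pi1.
have Dneg : 0 < - D i1 by rewrite oppr_gt0 lt_neqAle Di1 (eigen_le0 (eig i1) wx1).
have gapE : gap q = - D i1.
  apply/eqP; rewrite eq_le; apply/andP; split.
    by have [/eqP|//] := gap_le_eigen (eig i1) wx1; rewrite (negbTE Di1).
  apply: lb_le_inf.
    exists (- D i1); split => //; apply/eigenvalue_gen.
    by exists (w i1); [move=> x; rewrite opprK|exists x1].
  move=> l [l0 /eigenvalue_gen[f fl [x fx]]].
  have [i ci] : exists i, \sum_y w i y * f y != 0.
    apply/existsP; rewrite -[X in is_true X]negbK; apply/negP => /existsPn c0.
    move: fx; rewrite (frame_expansion f x par) big1 ?eqxx // => i _.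
    by have /negPn/eqP -> := c0 i; rewrite mul0r.
  have : D i * (\sum_y w i y * f y) = - l * (\sum_y w i y * f y).
    have := gen_self_adjoint qsym (w i) f.
    under eq_bigr do rewrite eig -mulrA.
    under [X in _ = X -> _]eq_bigr do rewrite fl mulrCA.
    by rewrite -!mulr_sumr.
  move=> /(mulIf ci) Di.
  have := mini i; rewrite Di opprK; apply.
  rewrite /P Di oppr_eq0 gt_eqF //=; apply/existsP.
  case: (pickP (fun x => w i x != 0)) => [z wz|w0]; first by exists z.
  case/eqP: ci; rewrite big1 // => y _.
  by have /negbFE/eqP -> := w0 y; rewrite mul0r.
pose c := Num.sqrt (expect (fun x => w i1 x ^+ 2)).
have e0 : 0 < expect (fun x => w i1 x ^+ 2).
  rewrite lt_neqAle eq_sym expect_ge0 ?andbT => [|x]; last exact: sqr_ge0.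
  by apply: contra wx1 => /eqP /(expect_sqr_eq0 S_gt0) ->.
have c0 : 0 < c by rewrite sqrtr_gt0.
have geig x : gen q (fun x => c^-1 * w i1 x) x = - gap q * (c^-1 * w i1 x).
  rewrite gapE opprK mulrCA -eig /gen mulr_sumr.
  by apply: eq_bigr => y _; ring.
exists (fun x => c^-1 * w i1 x); split => //.
- by rewrite gapE.
- have /eqP := expect_eigen geig; rewrite mulf_eq0 oppr_eq0 gapE.
  by rewrite (negbTE (lt0r_neq0 Dneg)) /= => /eqP.
- rewrite /expect; under eq_bigr do rewrite exprMn mulrCA.
  rewrite -mulr_sumr -/(expect (fun x => w i1 x ^+ 2)).
  by rewrite -[X in _ * X](@sqr_sqrtr R) ?ltW // -/c exprVn mulVf // sqrf_eq0 gt_eqF.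
Qed.

Lemma expect_sqr_semigroup (I : finType) (w : I -> S -> R) (D : I -> R) t f :
  (forall x y, \sum_i w i x * w i y = (x == y)%:R) ->
  (forall i x, gen q (w i) x = D i * w i x) ->
  (forall t x y, transition q t x y = \sum_i expR (t * D i) * (w i x * w i y)) ->
  expect (fun x => semigroup q t f x ^+ 2) =
  #|S|%:R^-1 * \sum_i (expR (t * D i) * \sum_y w i y * f y) ^+ 2.
Proof.
move=> par eig tr; rewrite /expect /unif -mulr_sumr; congr (_ * _).
under eq_bigr do rewrite expr2 {1}(semigroup_frame _ f _ tr) mulr_suml.
rewrite exchange_big; apply: eq_bigr => i _ /=.
under eq_bigr do rewrite -mulrA.
rewrite -mulr_sumr expr2; congr (_ * _).
rewrite -semigroup_self_adjoint // mulr_sumr.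
by apply: eq_bigr => y _; rewrite (@semigroup_eigen _ _ _ qsym _ (D i)) // mulrA.
Qed.

Lemma expect_sqr_frame (I : finType) (w : I -> S -> R) f :
  (forall x y, \sum_i w i x * w i y = (x == y)%:R) ->
  expect (fun x => f x ^+ 2) = #|S|%:R^-1 * \sum_i (\sum_y w i y * f y) ^+ 2.
Proof.
move=> par; rewrite /expect /unif -mulr_sumr; congr (_ * _).
under eq_bigr do rewrite expr2 {1}(frame_expansion f _ par) mulr_suml.
rewrite exchange_big; apply: eq_bigr => i _ /=.
by rewrite expr2 [RHS]mulr_sumr; apply: eq_bigr => y _; rewrite -mulrA.
Qed.

Lemma poincare f : expect f = 0 ->
  gap q * expect (fun x => f x ^+ 2) <= dirichlet q f.
Proof.
move=> f0; have [I [w [D [par eig tr]]]] := chain_frame qsym.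
rewrite (expect_sqr_frame _ par) dirichletE /expect /unif -mulr_sumr -mulrN.
rewrite mulrCA ler_pM2l ?invr_gt0 // -gen_self_adjoint //.
have -> : \sum_x gen q f x * f x = \sum_i D i * (\sum_y w i y * f y) ^+ 2.
  under eq_bigr do rewrite mulrC {1}(frame_expansion f _ par) mulr_suml.
  rewrite exchange_big; apply: eq_bigr => i _ /=.
  under eq_bigr do rewrite -mulrA.
  rewrite -mulr_sumr -gen_self_adjoint // expr2 mulrCA; congr (_ * _).
  by rewrite mulr_sumr; apply: eq_bigr => y _; rewrite eig mulrA.
rewrite mulr_sumr -sumrN ler_sum // => i _; rewrite -mulNr.
have [->|h] := frame_coef_eq0_or_gap i eig f0; first by rewrite expr0n /= !mulr0.
by rewrite ler_wpM2r // sqr_ge0.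
Qed.

Lemma semigroup_decay t f : 0 <= t -> expect f = 0 ->
  expect (fun x => semigroup q t f x ^+ 2) <=
  expR (- gap q * t) ^+ 2 * expect (fun x => f x ^+ 2).
Proof.
move=> t0 f0; have [I [w [D [par eig tr]]]] := chain_frame qsym.
rewrite (expect_sqr_semigroup t f par eig tr) (expect_sqr_frame f par) mulrCA.
rewrite ler_pM2l ?invr_gt0 // mulr_sumr ler_sum // => i _.
have [->|h] := frame_coef_eq0_or_gap i eig f0; first by rewrite mulr0 expr0n /= !mulr0.
rewrite exprMn ler_wpM2r ?sqr_ge0 // lerXn2r ?nnegrE ?expR_ge0 //.
by rewrite ler_expR mulrC ler_wpM2r // lerNr.
Qed.

End Gap.

(** The set whose infimum is [tmix q] is not empty: the variance of the
    semigroup tends to 0, and on a finite set it controls every value. *)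
Lemma exists_mixing_time (R : realType) (S : finType) (q : S -> S -> R) :
  (1 < #|S|)%N ->
  (forall x y, q x y = q y x) -> (forall x y, 0 <= q x y) ->
  (forall f, (forall x y, q x y * (f x - f y) ^+ 2 = 0) -> forall x y, f x = f y) ->
  exists t : R, 0 <= t /\
    forall x, tv_dist (transition q t x) (@unif R S) <= 1 / 4.
Proof.
move=> S2 qsym qge0 irr.
have [_ [g0 _ _ _]] := gap_eigenfunction qsym qge0 S2 irr.
set n : R := #|S|%:R; have n1 : 1 <= n by rewrite ler1n ltnW.
have n0 : 0 < n by lra.
have t0 : 0 <= 4 * n / gap q by rewrite divr_ge0 ?ltW // mulr_gt0.
exists (4 * n / gap q); split => // x.
apply: tv_dist_transition_le => //; first by rewrite ltnW.
move=> B.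
have := semigroup_decay qsym qge0 S2 irr t0 (expect_centered R (ltnW S2) B).
set g := semigroup q _ _; set eta := expR _ => dec.
have eta0 : 0 < eta by exact: expR_gt0.
have eta_le : eta <= (4 * n)^-1.
  rewrite /eta mulNr mulrC divfK ?gt_eqF // expRN lef_pV2 ?posrE ?expR_gt0 ?mulr_gt0 //.
  by have := expR_ge1Dx (4 * n); lra.
have Ef2 := expect_centered_sqr_le1 R (ltnW S2) B.
have gx : g x ^+ 2 <= n * expect (fun y => g y ^+ 2).
  rewrite -expect_sum; last by rewrite ltnW.
  by rewrite (bigD1 x) //= lerDl sumr_ge0 // => y _; exact: sqr_ge0.
have gx2 : g x ^+ 2 <= (1 / 4) ^+ 2.
  apply: le_trans gx _; apply: (@le_trans _ _ (n * eta ^+ 2)).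
    rewrite ler_pM2l //; apply: le_trans dec _.
    by rewrite ler_piMr // sqr_ge0.
  have : n * eta <= 1 / 4.
    apply: (@le_trans _ _ (n * (4 * n)^-1)); first by rewrite ler_pM2l.
    by rewrite invfM mulrCA divff ?gt_eqF //; lra.
  have : eta <= 1 / 4.
    apply: le_trans eta_le _; rewrite div1r lef_pV2 ?posrE ?mulr_gt0 //; lra.
  move=> e1 e2; rewrite !expr2 mulrA.
  apply: (@le_trans _ _ (1 / 4 * eta)); first by rewrite ler_pM2r.
  by rewrite ler_pM2l //; lra.
rewrite leNgt; apply/negP => h.
have : (1 / 4) ^+ 2 < g x ^+ 2 by rewrite ltrXn2r //; lra.
by rewrite ltNge gx2.
Qed.

(** * Log-Sobolev constant and spread of the gap eigenfunction *)

Lemma ln_le_sub1 (R : realType) (x : R) : 0 < x -> ln x <= x - 1.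
Proof. by move=> x0; have := @le_ln1Dx R (x - 1); rewrite subrKC; apply; lra. Qed.

Lemma mul_ln_ge (R : realType) (x : R) : 0 < x -> x - 1 <= x * ln x.
Proof.
move=> x0; have := ln_le_sub1 (_ : 0 < x^-1); rewrite invr_gt0 => /(_ x0).
rewrite lnV ?posrE // => /(ler_wpM2l (ltW x0)).
by rewrite mulrBr divff ?gt_eqF // mulr1; lra.
Qed.

Section Entropy.
Variables (R : realType) (S : finType).
Hypothesis S_gt0 : (0 < #|S|)%N.
Implicit Types (f g h : S -> R).
Local Notation n := (#|S|%:R : R).

Lemma entropyE g : (forall x, 0 < g x) ->
  entropy g = expect (fun x => g x * ln (g x / expect g)).
Proof.
move=> g0; rewrite /entropy; apply: eq_expect => x; congr (_ * ln (_ / _)).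
by apply: eq_expect => y; rewrite gtr0_norm.
Qed.

Lemma entropy_ge0 g : (forall x, 0 < g x) -> 0 <= entropy g.
Proof.
move=> g0; rewrite entropyE //; have m0 := expect_gt0 S_gt0 g0; set m := expect g in m0 *.
have -> : 0 = expect (fun x => g x + - m) :> R by rewrite expectD expect_cst // subrr.
apply: le_expect => x; have := mul_ln_ge (divr_gt0 (g0 x) m0).
by rewrite mulrAC ler_pdivlMr // mulrBl divfK ?gt_eqF // mul1r.
Qed.

Lemma entropy_le_variance g : (forall x, 0 < g x) ->
  expect g * entropy g <= expect (fun x => g x ^+ 2) - expect g ^+ 2.
Proof.
move=> g0; rewrite entropyE //; have m0 := expect_gt0 S_gt0 g0; set m := expect g in m0 *.
rewrite -expectZ.
have -> : expect (fun x => g x ^+ 2) - m ^+ 2 = expect (fun x => g x ^+ 2 + - m * g x).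
  by rewrite expectD expectZ -/m; ring.
apply: le_expect => x; have gm := divr_gt0 (g0 x) m0.
have := ler_wpM2l (ltW (mulr_gt0 m0 (g0 x))) (ln_le_sub1 gm).
rewrite -mulrA; move/le_trans; apply; rewrite le_eqVlt; apply/orP; left; apply/eqP.
by field; rewrite gt_eqF.
Qed.

(** With [M] the quadratic mean of [h] and [u = h / M], averaging
    [u ln u >= u - 1] with weight [2 h M] bounds the entropy below by
    [2 M (M - E h)], which is at least the variance since [E h <= M]. *)
Lemma entropy_sqr_ge_variance h : (forall x, 0 < h x) ->
  expect (fun x => h x ^+ 2) - expect h ^+ 2 <= entropy (fun x => h x ^+ 2).
Proof.
move=> h0; have h20 x : 0 < h x ^+ 2 by rewrite exprn_gt0.
rewrite entropyE //; have m0 := expect_gt0 S_gt0 h20; set m := expect _ in m0 *.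
pose M := Num.sqrt m; have M0 : 0 < M by rewrite sqrtr_gt0.
have mM : m = M ^+ 2 by rewrite sqr_sqrtr // ltW.
apply: (@le_trans _ _ (expect (fun x => 2 * h x ^+ 2 + (- 2 * M) * h x))).
  rewrite expectD !expectZ -/m mM.
  have var0 : 0 <= expect (fun x => (h x - expect h) ^+ 2).
    by apply: expect_ge0 => x; exact: sqr_ge0.
  have eV : expect (fun x => (h x - expect h) ^+ 2) = M ^+ 2 - expect h ^+ 2.
    rewrite (@eq_expect _ _ _ (fun x => (h x ^+ 2 + (- 2 * expect h) * h x) + expect h ^+ 2)).
      by rewrite !expectD expectZ expect_cst // -/m mM; ring.
    by move=> x; ring.
  rewrite eV in var0; move: (expect_gt0 S_gt0 h0) var0; set a := expect h => a0 var0.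
  have := sqr_ge0 (M - a); rewrite sqrrB; lra.
apply: le_expect => x; rewrite mM -expr_div_n lnXn ?divr_gt0 //.
set u := h x / M; have u0 : 0 < u by rewrite divr_gt0.
have hu : h x = u * M by rewrite /u divfK ?gt_eqF.
have := ler_wpM2l (ltW (mulr_gt0 (h0 x) M0)) (mul_ln_ge u0).
by rewrite hu; lra.
Qed.

(** A crude comparison, used only to see that the log-Sobolev constant of a
    finite irreducible chain is not 0: the entropy of [h ^+ 2] is at most its
    variance divided by its mean, and [h ^+ 2] is at most [n] times its mean. *)
Lemma entropy_sqr_le (h : S -> R) : (forall x, 0 < h x ^+ 2) ->
  entropy (fun x => h x ^+ 2) <=
  4 * n * expect (fun x => (h x - expect h) ^+ 2).
Proof.
move=> h20; have m0 := expect_gt0 S_gt0 h20; set m := expect _ in m0 *.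
have := entropy_le_variance h20; rewrite -/m => le.
set a := expect h; set W := expect (fun x => (h x - a) ^+ 2).
have eW : W = m - a ^+ 2.
  rewrite /W (@eq_expect _ _ _ (fun x => (h x ^+ 2 + (- 2 * a) * h x) + a ^+ 2)).
    by rewrite !expectD expectZ expect_cst // -/m -/a; ring.
  by move=> x; ring.
have W0 : 0 <= W by apply: expect_ge0 => x; exact: sqr_ge0.
have n1 : 1 <= n by rewrite ler1n.
have a2 : a ^+ 2 <= n * m.
  have : a ^+ 2 <= m by lra.
  by have := ler_wpM2r (ltW m0) n1; lra.
have h2 x : h x ^+ 2 <= n * m.
  rewrite -expect_sum //.
  by rewrite (bigD1 x) //= lerDl sumr_ge0 // => y _; rewrite ltW.
have var : expect (fun x => (h x ^+ 2) ^+ 2) - m ^+ 2 <=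
    expect (fun x => (h x ^+ 2 - a ^+ 2) ^+ 2).
  rewrite [leRHS](@eq_expect _ _ _ (fun x => ((h x ^+ 2) ^+ 2 +
     (- 2 * a ^+ 2) * h x ^+ 2) + (a ^+ 2) ^+ 2)).
    rewrite !expectD expectZ expect_cst // -/m.
    by have := sqr_ge0 (m - a ^+ 2); rewrite sqrrB; lra.
  by move=> x; ring.
rewrite -(ler_pM2l m0); apply: le_trans le _; apply: le_trans var _.
rewrite (_ : m * (4 * n * W) = (4 * (n * m)) * W); last by ring.
rewrite /W -expectZ; apply: le_expect => x.
rewrite (_ : (h x ^+ 2 - a ^+ 2) ^+ 2 = (h x + a) ^+ 2 * (h x - a) ^+ 2); last by ring.
rewrite ler_wpM2r ?sqr_ge0 //.
have := sqr_ge0 (h x - a); have := h2 x.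
have -> : (h x - a) ^+ 2 = h x ^+ 2 - 2 * (h x * a) + a ^+ 2 by ring.
have -> : (h x + a) ^+ 2 = h x ^+ 2 + 2 * (h x * a) + a ^+ 2 by ring.
lra.
Qed.

End Entropy.

Section LogSobolev.
Variables (R : realType) (S : finType) (q : S -> S -> R).
Hypothesis cardS : (1 < #|S|)%N.

Let S_gt0 : (0 < #|S|)%N := ltnW cardS.

Hypothesis qsym : forall x y, q x y = q y x.
Hypothesis q_ge0 : forall x y, 0 <= q x y.
Hypothesis irr : forall f,
  (forall x y, q x y * (f x - f y) ^+ 2 = 0) -> forall x y, f x = f y.
Implicit Types (f g h : S -> R).
Local Notation n := (#|S|%:R : R).

Let n_gt0 : 0 < n.
Proof. by rewrite ltr0n. Qed.

Lemma dirichlet_affine f (a c : R) :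
  dirichlet q (fun x => c + a * f x) = a ^+ 2 * dirichlet q f.
Proof.
rewrite /dirichlet mulrCA; congr (_ * _); rewrite mulr_sumr; apply: eq_bigr => x _.
rewrite mulr_sumr; apply: eq_bigr => y _; ring.
Qed.

Lemma logsob_entropy_le h : (forall x, 0 < h x ^+ 2) ->
  logsob q * entropy (fun x => h x ^+ 2) <= dirichlet q h.
Proof.
move=> h20; have [->|E0] := eqVneq (entropy (fun x => h x ^+ 2)) 0.
  by rewrite mulr0 dirichlet_ge0.
have Epos : 0 < entropy (fun x => h x ^+ 2) by rewrite lt_neqAle eq_sym E0 (entropy_ge0 S_gt0).
rewrite -ler_pdivlMr //; apply: ge_inf; last by exists h.
exists 0 => r [g [g20 _ ->]]; rewrite divr_ge0 ?dirichlet_ge0 //.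
exact: (entropy_ge0 S_gt0).
Qed.

(** Near a positive constant, entropy is bounded below by the variance; this
    compares the log-Sobolev constant with the gap. *)
Lemma exists_positive_perturbation f : expect f = 0 ->
  expect (fun x => f x ^+ 2) = 1 ->
  exists a : R, 0 < a /\ (forall x, 0 < 1 + a * f x) /\
    a ^+ 2 <= entropy (fun x => (1 + a * f x) ^+ 2).
Proof.
move=> f0 f1; pose s := 1 + \sum_x `|f x|; pose a := s^-1 / 2.
have s1 : 1 <= s by rewrite lerDl sumr_ge0.
have a0 : 0 < a by rewrite divr_gt0 // invr_gt0; lra.
have h0 x : 0 < 1 + a * f x.
  have fs : `|f x| <= s.
    rewrite /s (bigD1 x) //= addrCA lerDl addr_ge0 // sumr_ge0 //.
  have af : `|a * f x| <= 1 / 2.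
    rewrite normrM gtr0_norm // /a mulrAC ler_pM2r ?invr_gt0 //.
    by rewrite mulrC ler_pdivrMr ?mul1r //; lra.
  by move: af; rewrite ler_norml => /andP[]; lra.
exists a; split => //; split => //; apply: le_trans (entropy_sqr_ge_variance S_gt0 h0).
rewrite (_ : expect (fun x => 1 + a * f x) = 1); last first.
  by rewrite expectD expectZ f0 expect_cst // mulr0 addr0.
rewrite (@eq_expect _ _ _ (fun x => (1 + (2 * a) * f x) + a ^+ 2 * f x ^+ 2)).
  by rewrite !expectD !expectZ f0 f1 expect_cst //; lra.
by move=> x; ring.
Qed.

Lemma logsob_gt0 : 0 < logsob q.
Proof.
have [f [g0 f0 f1 fe]] := gap_eigenfunction qsym q_ge0 cardS irr.
apply: (@lt_le_trans _ _ (gap q / (4 * n))).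
  by rewrite divr_gt0 // mulr_gt0.
have [a [a0 [h0 aE]]] := exists_positive_perturbation f0 f1.
apply: lb_le_inf.
  exists (dirichlet q (fun x => 1 + a * f x) / entropy (fun x => (1 + a * f x) ^+ 2)).
  exists (fun x => 1 + a * f x); split => //; first by move=> x; rewrite exprn_gt0.
  by rewrite gt_eqF // (lt_le_trans _ aE) // exprn_gt0.
move=> r [h [h20 E0 ->]].
have Epos : 0 < entropy (fun x => h x ^+ 2) by rewrite lt_neqAle eq_sym E0 (entropy_ge0 S_gt0).
rewrite ler_pdivlMr // mulrAC ler_pdivrMr ?mulr_gt0 //.
pose f' x := - expect h + 1 * h x.
have f'0 : expect f' = 0 by rewrite /f' expectD expectZ expect_cst //; lra.
have := poincare qsym q_ge0 cardS irr f'0.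
rewrite dirichlet_affine expr1n mul1r => P.
have := ler_wpM2l (ltW g0) (entropy_sqr_le S_gt0 h20).
have -> : expect (fun x => (h x - expect h) ^+ 2) = expect (fun x => f' x ^+ 2).
  by apply: eq_expect => x; rewrite /f'; ring.
move=> /le_trans; apply; rewrite mulrCA [leRHS]mulrC.
by rewrite ler_pM2l // mulr_gt0.
Qed.

Lemma logsob_le_gap : logsob q <= gap q.
Proof.
have [f [g0 f0 f1 fe]] := gap_eigenfunction qsym q_ge0 cardS irr.
have [a [a0 [h0 aE]]] := exists_positive_perturbation f0 f1.
have a20 : 0 < a ^+ 2 by rewrite exprn_gt0.
have := @logsob_entropy_le (fun x => 1 + a * f x) (fun x => exprn_gt0 2 (h0 x)).
rewrite dirichlet_affine (dirichlet_eigen qsym fe) opprK f1 mulr1 => le.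
rewrite -(ler_pM2r a20) [leRHS]mulrC; apply: le_trans le.
by rewrite ler_pM2l // logsob_gt0.
Qed.

(** The infimum defining [logsob] only allows functions that vanish nowhere, so
    an eigenfunction has to be shifted slightly before it can be tested. *)
Lemma nonvanishing_shift f : exists c : R, [/\ 0 < c, c <= 1 / 4 &
  forall x, f x + c != 0].
Proof.
pose s := 1 + \sum_(x | f x != 0) `|f x|^-1.
have s1 : 1 <= s by rewrite lerDl sumr_ge0 // => x _; rewrite invr_ge0.
have c0 : 0 < s^-1 / 4 by rewrite divr_gt0 // invr_gt0; lra.
have c1 : s^-1 <= 1 by rewrite invf_le1 //; lra.
exists (s^-1 / 4); split => //; first by rewrite ler_pM2r ?invr_gt0.
move=> x; have [->|fx] := eqVneq (f x) 0; first by rewrite add0r gt_eqF.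
apply/negP => /eqP fc; have : `|f x| = s^-1 / 4.
  by rewrite (_ : f x = - (s^-1 / 4)) ?normrN ?gtr0_norm //; lra.
have nf : 0 < `|f x| by rewrite normr_gt0.
have : `|f x|^-1 <= s.
  rewrite /s (bigD1 x) //= addrCA lerDl addr_ge0 // sumr_ge0 //.
rewrite -[X in _ <= X]invrK lef_pV2 ?posrE ?invr_gt0 //; last by lra.
move=> h1 h2; have : 0 < s^-1 by rewrite invr_gt0; lra.
lra.
Qed.

(** The log-Sobolev inequality for [f] itself bounds the relative entropy of
    the probability with density [f ^+ 2] by [H].  Such a law puts little mass
    where its density exceeds [expR (4 * H + 1)], and also little mass where
    its density is below 1/4; so at least of order [n / expR (4 * H)] points
    have density above 1/4.  The shift by [c <= 1/4] lowers the resulting bound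
    on [`|f|] from 1/2 to 1/4. *)
Lemma eigenfunction_spread (H : R) f : 0 < H -> gap q <= H * logsob q ->
  expect f = 0 -> expect (fun x => f x ^+ 2) = 1 ->
  (forall x, gen q f x = - gap q * f x) ->
  n / 2 <= expR (4 * H + 1) * #|[set x | 1 / 4 <= `|f x|]|%:R.
Proof.
move=> H0 gH f0 f1 fe; have [c [c0 c4 fc]] := nonvanishing_shift f.
pose h x := c + 1 * f x.
have h20 x : 0 < h x ^+ 2.
  by rewrite lt_neqAle sqr_ge0 andbT eq_sym sqrf_eq0 /h mul1r addrC.
have := logsob_entropy_le h20; rewrite dirichlet_affine expr1n mul1r.
rewrite (dirichlet_eigen qsym fe) opprK f1 mulr1 => le.
have EH : entropy (fun x => h x ^+ 2) <= H.
  by rewrite -(ler_pM2l logsob_gt0) (mulrC _ H); exact: le_trans le gH.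
pose m := expect (fun x => h x ^+ 2).
have mE : m = 1 + c ^+ 2.
  rewrite /m (@eq_expect _ _ _ (fun x => (c ^+ 2 + (2 * c) * f x) + f x ^+ 2)).
    by rewrite !expectD !expectZ f0 f1 expect_cst //; lra.
  by move=> x; rewrite /h; ring.
have m1 : 1 <= m by rewrite mE lerDl sqr_ge0.
have m0 : 0 < m by lra.
pose g x := h x ^+ 2 / m; have g0 x : 0 < g x by rewrite divr_gt0.
have Eg : expect g = 1.
  rewrite (@eq_expect _ _ _ (fun x => m^-1 * h x ^+ 2)) => [|x]; last by rewrite mulrC.
  by rewrite expectZ -/m mulVf // gt_eqF.
have Eglng : expect (fun x => g x * ln (g x)) <= H.
  rewrite (@eq_expect _ _ _ (fun x => m^-1 * (h x ^+ 2 * ln (g x)))) => [|x]; last first.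
    by rewrite /g mulrAC mulrC.
  rewrite expectZ -/m; move: EH; rewrite entropyE // -/m; set E := expect _ => EH.
  have [E0|E0] := lerP 0 E.
    apply: le_trans EH; rewrite ler_piMl // invf_le1 //.
  by apply: le_trans (ltW H0); rewrite pmulr_rle0 ?invr_gt0 // ltW.
set K := expR (4 * H + 1); have K0 : 0 < K by exact: expR_gt0.
(* The three terms account for the points where [g] is small, moderate and
   large; in the last case [ln (g x) >= 4 * H + 1]. *)
have pt x : g x <= (1 / 4 + K * (1 / 4 <= g x)%R%:R) +
    (4 * H)^-1 * ((g x * ln (g x) + -1 * g x) + 1).
  have H40 : 0 < 4 * H by rewrite mulr_gt0.
  have third : 0 <= (4 * H)^-1 * ((g x * ln (g x) + -1 * g x) + 1).
    by rewrite mulr_ge0 ?invr_ge0 ?(ltW H40) //; have := mul_ln_ge (g0 x); lra.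
  case: (lerP (1 / 4) (g x)) => g4; rewrite ?mulr1n ?mulr0n; last by lra.
  have [gK|gK] := lerP (g x) K; first by lra.
  have lnK : 4 * H + 1 <= ln (g x) by rewrite -(expRK (4 * H + 1)) ler_ln ?posrE // ltW.
  have : g x <= (4 * H)^-1 * ((g x * ln (g x) + -1 * g x) + 1).
    rewrite mulrC ler_pdivlMr //.
    by have := ler_wpM2l (ltW (g0 x)) lnK; lra.
  lra.
have := le_expect pt; rewrite Eg !expectD !expectZ !expectD expectZ !expect_cst // Eg.
set P := expect (fun x => (1 / 4 <= g x)%R%:R); set L := expect _ => avg.
have KP : 1 / 2 <= K * P.
  have : (4 * H)^-1 * (L + -1 * 1 + 1) <= 1 / 4.
    by rewrite mulrC ler_pdivrMr ?mulr_gt0 //; move: Eglng; rewrite -/L; lra.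
  lra.
have nP : n * P <= #|[set x | 1 / 4 <= `|f x|]|%:R.
  rewrite -expect_sum //.
  rewrite -sum1_card natr_sum [leRHS]big_mkcond ler_sum // => x _; rewrite inE.
  case: (lerP (1 / 4) (g x)) => gx /=; last by case: ifP.
  suff -> : 1 / 4 <= `|f x| by [].
  have h4 : 1 / 4 <= h x ^+ 2.
    by move: gx; rewrite ler_pdivlMr //; lra.
  have : 1 / 2 <= `|h x|.
    rewrite -(@ler_pXn2r _ 2) ?nnegrE //; first by rewrite real_normK ?num_real // expr2; lra.
  have : `|h x| <= c + `|f x|.
    by rewrite /h mul1r; apply: le_trans (ler_normD _ _) _; rewrite gtr0_norm.
  lra.
have := ler_wpM2l (ltW n_gt0) KP; have := ler_wpM2l (ltW K0) nP; lra.
Qed.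

Lemma spread_eigenfunction (H : R) : 0 < H -> gap q <= H * logsob q -> exists f,
  [/\ expect f = 0, expect (fun x => f x ^+ 2) = 1,
      forall x, gen q f x = - gap q * f x &
      n / 4 <= expR (4 * H + 1) * #|[set x | 1 / 4 <= f x]|%:R].
Proof.
move=> H0 gH; have [f [g0 f0 f1 fe]] := gap_eigenfunction qsym q_ge0 cardS irr.
have := eigenfunction_spread H0 gH f0 f1 fe.
set K := expR _; have K0 : 0 < K by exact: expR_gt0.
pose f' x := -1 * f x.
have : #|[set x | 1 / 4 <= `|f x|]|%:R <= #|[set x | 1 / 4 <= f x]|%:R +
    #|[set x | 1 / 4 <= f' x]|%:R :> R.
  rewrite -natrD ler_nat; apply: leq_trans (leq_card_setU _ _).
  apply/subset_leq_card/fintype.subsetP => x; rewrite !inE /f' mulN1r.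
  by rewrite lerNr; case: (lerP 0 (f x)) => fx; rewrite ?(ger0_norm fx) ?(ltr0_norm fx) => h;
    apply/orP; [left|right]; lra.
move=> /(ler_wpM2l (ltW K0)); rewrite mulrDr.
have [h1 _ _|h1 h2 h3] := lerP (n / 4) (K * #|[set x | 1 / 4 <= f x]|%:R).
  by exists f.
exists f'; split.
- by rewrite expectZ f0 mulr0.
- by rewrite -f1; apply: eq_expect => x; rewrite /f'; ring.
- move=> x; rewrite /f' (mulrCA (- gap q)) -fe /gen mulr_sumr.
  by apply: eq_bigr => y _; ring.
- lra.
Qed.

End LogSobolev.

(** * The exclusion process *)

Section Exclusion.
Variables (R : realType) (V : finType) (e : rel V) (d : nat).
Hypothesis graph : connected_regular_graph e d.
Local Notation r := (rw_rate R e d).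

Lemma rw_rate_sym x y : r x y = r y x.
Proof. by case: graph => esym _ _ _ _; rewrite /rw_rate esym. Qed.

Lemma rw_rate_ge0 x y : 0 <= r x y.
Proof. by rewrite /rw_rate; case: ifP => // _; rewrite divr_ge0. Qed.

Lemma rw_rate_gt0 x y : e x y -> 0 < r x y.
Proof.
move=> exy; rewrite /rw_rate exy divr_gt0 // ltr0n.
case: graph => _ _ _ _ /(_ x) <-; apply/card_gt0P; by exists y.
Qed.

Lemma rw_irreducible (f : V -> R) :
  (forall x y, r x y * (f x - f y) ^+ 2 = 0) -> forall x y, f x = f y.
Proof.
move=> f0 x y; case: graph => _ _ _ /(_ x y) /connectP[p + ->] _.
elim: p x => [|z p IH] x //= /andP[exz pz]; rewrite -(IH z) //.
have /eqP := f0 x z; rewrite mulf_eq0 (negbTE (lt0r_neq0 (rw_rate_gt0 exz))) /=.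
by rewrite sqrf_eq0 subr_eq0 => /eqP.
Qed.

Variable k : nat.
Local Notation S := {A : {set V} | #|A| == k}.
Local Notation qx := (@ex_rate R V e d k).

Lemma swap_subproof x y (A : S) : #|tperm x y @: val A| == k.
Proof. by rewrite card_imset ?(valP A) //; exact: perm_inj. Qed.

Definition swap x y (A : S) : S :=
  exist (fun B : {set V} => #|B| == k) _ (swap_subproof x y A).

Lemma mem_swap x y z (A : S) : (z \in val (swap x y A)) = (tperm x y z \in val A).
Proof. by rewrite -{1}(tpermK x y z) mem_imset //; exact: perm_inj. Qed.

Lemma swapK x y : involutive (swap x y).
Proof. by move=> A; apply/val_inj/setP => z; rewrite !mem_swap tpermK. Qed.

(** The jump rates seen from the edges: when the edge [{x, y}] rings, [A] moves
    to [swap x y A]. *)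
Lemma ex_rate_sum (Phi : S -> R) A :
  \sum_B qx A B * Phi B = 2^-1 * \sum_x \sum_y r x y * Phi (swap x y A).
Proof.
transitivity (2^-1 * \sum_B \sum_x \sum_(y | swap x y A == B) r x y * Phi B).
  rewrite mulr_sumr; apply: eq_bigr => B _.
  rewrite /ex_rate -mulrA mulr_suml; congr (_ * _); apply: eq_bigr => x _.
  by rewrite mulr_suml; apply: eq_bigr => y _.
congr (_ * _); rewrite exchange_big; apply: eq_bigr => x _ /=.
under eq_bigr do rewrite big_mkcond /=.
rewrite exchange_big; apply: eq_bigr => y _ /=.
rewrite (bigD1 (swap x y A)) //= eqxx big1 ?addr0 // => B.
by rewrite eq_sym => /negbTE ->.
Qed.

Lemma ex_rate_sym A B : qx A B = qx B A.
Proof.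
rewrite /ex_rate; congr (_ * _); apply: eq_bigr => x _; apply: eq_bigl => y.
rewrite -[_ @: val A]/(val (swap x y A)) -[_ @: val B]/(val (swap x y B)).
by rewrite !(inj_eq val_inj) -{1}(swapK x y B) (inj_eq (inv_inj (swapK x y))) eq_sym.
Qed.

Lemma ex_rate_ge0 A B : 0 <= qx A B.
Proof.
rewrite /ex_rate mulr_ge0 ?invr_ge0 // sumr_ge0 // => x _; rewrite sumr_ge0 // => y _.
exact: rw_rate_ge0.
Qed.

Lemma ex_rate_swap_gt0 x y A : e x y -> 0 < qx A (swap x y A).
Proof.
move=> exy; rewrite /ex_rate pmulr_rgt0 ?invr_gt0 // (bigD1 x) //=.
rewrite (bigD1 y) //= ltr_pwDl // ?ltr_pwDl ?rw_rate_gt0 //.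
  by rewrite sumr_ge0 // => z _; exact: rw_rate_ge0.
rewrite sumr_ge0 // => z _; rewrite sumr_ge0 // => u _; exact: rw_rate_ge0.
Qed.

Lemma swap_diff a b (A B : S) : a \in val A :\: val B -> b \in val B :\: val A ->
  (#|val (swap a b A) :\: val B| < #|val A :\: val B|)%N.
Proof.
rewrite !inE => /andP[aB aA] /andP[bA bB].
apply: proper_card; apply/properP; split.
  apply/fintype.subsetP => z; rewrite !inE mem_swap => /andP[zB].
  case: tpermP => [->|zb|_ _ -> //]; last by rewrite zB.
    by rewrite (negbTE bA).
  by rewrite zb bB in zB.
exists a; first by rewrite !inE aB.
by rewrite inE mem_swap tpermL (negbTE bA) andbF.
Qed.

(** The edges of a connected graph generate all transpositions, and exchanging
    a point of [A :\: B] with a point of [B :\: A] brings [A] closer to [B]. *)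
Lemma ex_irreducible (Phi : S -> R) :
  (forall A B, qx A B * (Phi A - Phi B) ^+ 2 = 0) -> forall A B, Phi A = Phi B.
Proof.
move=> P0.
have edge x y A : e x y -> Phi (swap x y A) = Phi A.
  move=> exy; have /eqP := P0 A (swap x y A); rewrite mulf_eq0.
  rewrite (negbTE (lt0r_neq0 (ex_rate_swap_gt0 A exy))) /=.
  by rewrite sqrf_eq0 subr_eq0 => /eqP.
have any x y : forall A, Phi (swap x y A) = Phi A.
  case: graph => _ _ _ /(_ x y) /connectP[p + ->] _.
  elim/last_ind: p => [|p z IH] /=.
    by move=> _ A; congr Phi; apply/val_inj/setP => z; rewrite mem_swap tperm1 perm1.
  rewrite rcons_path last_rcons => /andP[/IH {}IH eyz] A.
  set y' := last x p in IH eyz.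
  have [->|zx] := eqVneq z x.
    by congr Phi; apply/val_inj/setP => u; rewrite mem_swap tperm1 perm1.
  have [xy|xy] := eqVneq x y'; first by rewrite xy; exact: edge.
  rewrite -(edge y' z A eyz) -(IH (swap y' z A)).
  rewrite -(edge y' z (swap x y' (swap y' z A)) eyz); congr Phi.
  apply/val_inj/setP => u; rewrite !mem_swap.
  suff -> : tperm y' z (tperm x y' (tperm y' z u)) = tperm x z u by [].
  have yz : y' != z by case: graph => _ irr _ _ _; apply: contraTneq eyz => ->; rewrite irr.
  have := tpermJ x y' (tperm y' z); rewrite tpermL tpermD // 1?eq_sym //.
  by rewrite conjgE tpermV => <-; rewrite !permM.
move=> A B; have [n] := ubnP #|val A :\: val B|; elim: n A => // n IH A.
rewrite ltnS => An; have [A0|[a aAB]] := set_0Vmem (val A :\: val B).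
  congr Phi; apply/val_inj/eqP; rewrite eqEcard (eqP (valP A)) (eqP (valP B)) leqnn.
  by rewrite andbT -finset.setD_eq0 A0.
have /set0Pn[b bBA] : val B :\: val A != finset.set0.
  have cAB : #|val A| = #|val B| by rewrite (eqP (valP A)) (eqP (valP B)).
  rewrite -card_gt0 cardsD finset.setIC -cAB -cardsD.
  by apply/card_gt0P; exists a.
rewrite -(any a b A); apply: IH; apply: leq_trans An; exact: swap_diff.
Qed.

Definition occupied_sum (g : V -> R) (A : S) : R := \sum_(a in val A) g a.

Lemma occupied_sum_swap g x y A : occupied_sum g (swap x y A) - occupied_sum g A =
  ((x \in val A)%:R - (y \in val A)%:R) * (g y - g x).
Proof.
have [->|xy] := eqVneq x y.
  rewrite subrr mul0r; apply/eqP; rewrite subr_eq0; apply/eqP; congr occupied_sum.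
  by apply/val_inj/setP => z; rewrite mem_swap tperm1 perm1.
have E B : occupied_sum g B = \sum_a (a \in val B)%:R * g a.
  rewrite /occupied_sum big_mkcond; apply: eq_bigr => a _.
  by case: (_ \in _); rewrite ?mul1r ?mul0r.
rewrite !E -sumrB (bigD1 x) //= (bigD1 y) 1?eq_sym //= big1 ?addr0.
  by rewrite !mem_swap tpermL tpermR; ring.
by move=> z /andP[zx zy]; rewrite mem_swap tpermD 1?eq_sym // subrr.
Qed.

Lemma ex_gen_swap (Phi : S -> R) A : gen qx Phi A =
  2^-1 * \sum_x \sum_y r x y * (Phi (swap x y A) - Phi A).
Proof. exact: (ex_rate_sum (fun B => Phi B - Phi A)). Qed.

(** One-particle observables are preserved by the exclusion generator: this is
    the self-duality of symmetric exclusion for one particle. *)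
Lemma ex_gen_occupied_sum g A : gen qx (occupied_sum g) A = occupied_sum (gen r g) A.
Proof.
rewrite ex_gen_swap; under eq_bigr do under eq_bigr do rewrite occupied_sum_swap.
transitivity (\sum_x \sum_y r x y * ((x \in val A)%:R * (g y - g x))).
  have -> : \sum_x \sum_y r x y * (((x \in val A)%:R - (y \in val A)%:R) *
      (g y - g x)) = \sum_x \sum_y r x y * ((x \in val A)%:R * (g y - g x)) +
      \sum_x \sum_y r x y * ((y \in val A)%:R * (g x - g y)).
    rewrite -big_split; apply: eq_bigr => x _ /=.
    by rewrite -big_split; apply: eq_bigr => y _ /=; ring.
  rewrite [X in _ + X]exchange_big /=.
  under [X in _ + X]eq_bigr do under eq_bigr do rewrite rw_rate_sym.
  set s := \sum_x _; lra.
rewrite /occupied_sum [RHS]big_mkcond; apply: eq_bigr => x _.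
case: (_ \in _); first by apply: eq_bigr => y _; rewrite mul1r.
by rewrite big1 // => y _; rewrite mul0r mulr0.
Qed.

(** A ring of an edge changes [occupied_sum g] only if exactly one endpoint is
    occupied; independent particles would move in at least those cases. *)
Lemma ex_gen_occupied_sum_sqr g A :
  gen qx (fun B => occupied_sum g B ^+ 2) A -
    2 * occupied_sum g A * gen qx (occupied_sum g) A <=
  occupied_sum (fun x => gen r (fun y => g y ^+ 2) x - 2 * g x * gen r g x) A.
Proof.
rewrite gen_sqr (ex_rate_sum (fun B => (occupied_sum g B - occupied_sum g A) ^+ 2)).
under eq_bigr do under eq_bigr do rewrite occupied_sum_swap.
have -> : occupied_sum (fun x => gen r (fun y => g y ^+ 2) x - 2 * g x * gen r g x) A =
  \sum_x \sum_y r x y * ((x \in val A)%:R * (g y - g x) ^+ 2).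
  rewrite /occupied_sum big_mkcond; apply: eq_bigr => x _.
  case: (_ \in _); first by rewrite gen_sqr; apply: eq_bigr => y _; rewrite mul1r.
  by rewrite big1 // => y _; rewrite mul0r mulr0.
set s := (leRHS); have : \sum_x \sum_y r x y * (((x \in val A)%:R -
    (y \in val A)%:R) * (g y - g x)) ^+ 2 <= s + s.
  have {2}-> : s = \sum_x \sum_y r x y * ((y \in val A)%:R * (g y - g x) ^+ 2).
    rewrite /s exchange_big; apply: eq_bigr => y _; apply: eq_bigr => x _ /=.
    by rewrite rw_rate_sym; ring.
  rewrite -big_split ler_sum //= => x _; rewrite -big_split ler_sum //= => y _.
  rewrite -mulrDr ler_wpM2l ?rw_rate_ge0 // exprMn -mulrDl ler_wpM2r ?sqr_ge0 //.
  by case: (x \in _); case: (y \in _); rewrite /= ?subrr ?sub0r ?subr0; lra.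
set s' := \sum_x _; lra.
Qed.

Lemma occupied_sum_sum (I : finType) (c : I -> R) (u : I -> V -> R) A :
  occupied_sum (fun x => \sum_i c i * u i x) A = \sum_i c i * occupied_sum (u i) A.
Proof.
rewrite /occupied_sum exchange_big; apply: eq_bigr => i _ /=.
by rewrite mulr_sumr.
Qed.

Lemma eq_occupied_sum g h A : g =1 h -> occupied_sum g A = occupied_sum h A.
Proof. by move=> gh; apply: eq_bigr => x _. Qed.

Lemma occupied_sumZ a g A :
  occupied_sum (fun x => a * g x) A = a * occupied_sum g A.
Proof. by rewrite /occupied_sum mulr_sumr. Qed.

Lemma occupied_sumD g h A :
  occupied_sum (fun x => g x + h x) A = occupied_sum g A + occupied_sum h A.
Proof. by rewrite /occupied_sum big_split. Qed.

Lemma ex_semigroup_occupied_sum t g A :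
  semigroup qx t (occupied_sum g) A = occupied_sum (semigroup r t g) A.
Proof.
have [I [w [D [par eig tr]]]] := chain_frame rw_rate_sym.
have eF B : occupied_sum g B = \sum_i (\sum_y w i y * g y) * occupied_sum (w i) B.
  by rewrite -occupied_sum_sum; apply: eq_occupied_sum => x; exact: frame_expansion.
rewrite (eq_semigroup qx t eF) semigroup_sum.
rewrite (eq_occupied_sum _ (fun x => semigroup_frame t g x tr)) occupied_sum_sum.
apply: eq_bigr => i _; rewrite (@semigroup_eigen _ _ _ ex_rate_sym t (D i)).
  by rewrite mulrA (mulrC (expR _)).
by move=> B; rewrite ex_gen_occupied_sum (eq_occupied_sum _ (eig i)) occupied_sumZ.
Qed.

(** A one-particle observable fluctuates no more under exclusion than under
    independent walkers.  Follow [Psi s], the difference between [g s ^+ 2]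
    summed over the particles and the square of the sum of [g s], where
    [g s] is the walk semigroup at the remaining time [t - s]: its expected
    value is nondecreasing in [s], since its drift is the difference of the
    two sides of [ex_gen_occupied_sum_sqr]. *)
Lemma ex_variance (t : R) f A : 0 <= t ->
  \sum_B transition qx t A B *
    (occupied_sum f B - occupied_sum (semigroup r t f) A) ^+ 2 <=
  occupied_sum (semigroup r t (fun x => f x ^+ 2)) A.
Proof.
move=> t0.
pose g s := semigroup r (t - s) f.
have dg (s : R) x : is_derive s 1 (fun s => g s x) (- gen r (g s) x).
  have h : is_derive s 1 (fun s : R => t - s) (-1).
    have -> : (fun s : R => t - s) = cst t - id by [].
    by apply: is_derive_eq; rewrite sub0r.
  have := @is_derive1_comp _ (fun u => semigroup r u f x) (fun s => t - s) _ _ _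
    (is_derive_semigroup rw_rate_sym (t - s) f x) h.
  by rewrite semigroup_gen ?mulrN1 //; exact: rw_rate_sym.
have dF (s : R) B (h : R -> V -> R) dh :
    (forall x, is_derive s 1 (fun s => h s x) (dh x)) ->
    is_derive s 1 (fun s => occupied_sum (h s) B) (occupied_sum dh B).
  move=> hd; have E u : occupied_sum u B = \sum_a (a \in val B)%:R * u a.
    rewrite /occupied_sum big_mkcond; apply: eq_bigr => a _.
    by case: (_ \in _); rewrite ?mul1r ?mul0r.
  rewrite (_ : (fun s => _) = (fun s => \sum_a (a \in val B)%:R * h s a)).
    by rewrite E; apply: is_derive_fsum => a; exact: is_deriveZ.
  by apply/funext => u; rewrite E.
pose Psi s B := occupied_sum (fun x => g s x ^+ 2) B - occupied_sum (g s) B ^+ 2.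
pose dPsi s B := occupied_sum (fun x => - (2 * g s x * gen r (g s) x)) B +
   2 * occupied_sum (g s) B * occupied_sum (gen r (g s)) B.
have dP (s : R) B : is_derive s 1 (Psi^~ B) (dPsi s B).
  have d1 : is_derive s 1 (fun s => occupied_sum (fun x => g s x ^+ 2) B)
     (occupied_sum (fun x => - (2 * g s x * gen r (g s) x)) B).
    apply: dF => x; have := is_deriveX 2 (dg s x).
    congr (is_derive _ _ _ _); rewrite /GRing.scale /=; ring.
  have := is_deriveB d1 (is_deriveX 2 (dF s B g _ (dg s))).
  congr (is_derive _ _ _ _); rewrite /dPsi /GRing.scale /=.
  have -> : occupied_sum (fun x => - gen r (g s) x) B = - occupied_sum (gen r (g s)) B.
    by rewrite -mulN1r -occupied_sumZ; apply: eq_occupied_sum => x; rewrite mulN1r.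
  ring.
have mono : semigroup qx 0 (Psi 0) A <= semigroup qx t (Psi t) A.
  apply: (le_of_derive_ge0 (fun s => is_derive_semigroup_path A ex_rate_sym (dP s)))
    => // s /andP[s0 _].
  rewrite sumr_ge0 // => B _; rewrite mulr_ge0 //.
    by apply: transition_ge0 => //; [exact: ex_rate_sym|exact: ex_rate_ge0].
  have := ex_gen_occupied_sum_sqr (g s) B; rewrite ex_gen_occupied_sum occupied_sumD.
  rewrite /dPsi.
  have -> : gen qx (Psi s) B = gen qx (occupied_sum (fun x => g s x ^+ 2)) B -
      gen qx (fun B => occupied_sum (g s) B ^+ 2) B.
    rewrite /gen -sumrB; apply: eq_bigr => C _; rewrite /Psi; ring.
  rewrite ex_gen_occupied_sum; lra.
move: mono; rewrite (semigroup0 ex_rate_sym).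
set m := occupied_sum (semigroup r t f) A.
have g0 : g 0 =1 semigroup r t f by move=> x; rewrite /g subr0.
have gt : g t =1 f by move=> x; rewrite /g subrr (semigroup0 rw_rate_sym).
have -> : Psi 0 A = occupied_sum (fun x => semigroup r t f x ^+ 2) A - m ^+ 2.
  rewrite /Psi (eq_occupied_sum _ g0); congr (_ - _).
  by apply: eq_occupied_sum => x; rewrite g0.
have PsiT B : Psi t B = occupied_sum (fun x => f x ^+ 2) B + -1 * occupied_sum f B ^+ 2.
  rewrite /Psi (eq_occupied_sum _ gt) mulN1r; congr (_ - _).
  by apply: eq_occupied_sum => x; rewrite gt.
rewrite (eq_semigroup qx t PsiT) semigroupD semigroupZ ex_semigroup_occupied_sum.
have -> : \sum_B transition qx t A B * (occupied_sum f B - m) ^+ 2 =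
    semigroup qx t (fun B => occupied_sum f B ^+ 2) A - m ^+ 2.
  transitivity (semigroup qx t (fun B => (occupied_sum f B ^+ 2 + - (2 * m) * occupied_sum f B)
      + m ^+ 2) A).
    by apply: eq_bigr => B _; ring.
  rewrite !semigroupD semigroupZ (semigroup_cst ex_rate_sym) ex_semigroup_occupied_sum -/m.
  ring.
have : 0 <= occupied_sum (fun x => semigroup r t f x ^+ 2) A.
  by rewrite sumr_ge0 // => x _; exact: sqr_ge0.
lra.
Qed.

End Exclusion.

Lemma ksubset_card_gt1 (V : finType) (k : nat) : (0 < k)%N -> (k + k <= #|V|)%N ->
  (1 < #|{: {A : {set V} | #|A| == k}}|)%N.
Proof.
move=> k0 k2n.
have kn : (k <= #|V|)%N := leq_trans (leq_addr k k) k2n.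
have [A [_ cA]] : exists A : {set V}, finset.set0 \subset A /\ #|A| = k.
  by apply: exists_superset => //; rewrite cards0.
have [||B [sB cB]] := @exists_superset V (#|V| - k) A.
- by rewrite cA leq_subRL.
- exact: leq_subr.
have cB' : #|~: B| = k by rewrite cardsCs finset.setCK cB subKn.
apply/card_gt1P.
exists (exist (fun B : {set V} => #|B| == k) A (introT eqP cA)).
exists (exist (fun B : {set V} => #|B| == k) (~: B) (introT eqP cB')).
split => //; apply/negP => /eqP /(congr1 val) /= AB.
move: k0; rewrite -cA => /card_gt0P[x xA].
have := fintype.subsetP sB x xA; have := xA; rewrite {1}AB inE => /negP. by [].
Qed.

(** * Consequences of the mixing of exclusion for the random walk *)

Lemma expr16_7_8_le (R : realType) : (7 / 8 : R) ^+ 16 <= 1 / 8.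
Proof.
have sq_le (a b : R) : 0 <= a -> a <= b -> a ^+ 2 <= b ^+ 2.
  by move=> a0 ab; rewrite lerXn2r // nnegrE // (le_trans a0).
rewrite (_ : 16%N = (2 * (2 * (2 * 2)))%N) // !exprM.
have a1 : (7 / 8 : R) ^+ 2 <= 766 / 1000 by rewrite expr2; lra.
have a2 : (766 / 1000 : R) ^+ 2 <= 587 / 1000 by rewrite expr2; lra.
have a3 : (587 / 1000 : R) ^+ 2 <= 345 / 1000 by rewrite expr2; lra.
have a4 : (345 / 1000 : R) ^+ 2 <= 1 / 8 by rewrite expr2; lra.
apply: le_trans a4; apply: (sq_le); first by rewrite !exprn_ge0.
apply: le_trans a3; apply: (sq_le); first by rewrite !exprn_ge0.
by apply: le_trans a2; apply: (sq_le); first by rewrite !exprn_ge0.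
Qed.

Section ExclusionMixed.
Variables (R : realType) (V : finType) (e : rel V) (d : nat).
Hypothesis graph : connected_regular_graph e d.
Variables (k : nat) (t : R).
Local Notation r := (rw_rate R e d).
Local Notation S := {A : {set V} | #|A| == k}.
Local Notation qx := (@ex_rate R V e d k).
Local Notation n := (#|V|%:R : R).
Hypothesis t_ge0 : 0 <= t.
Hypothesis ex_mixed : forall A, tv_dist (transition qx t A) (@unif R _) <= 1 / 4.
Hypothesis k2n : (k + k <= #|V|)%N.
Hypothesis k_gt0 : (0 < k)%N.

Let rsym := rw_rate_sym R graph.
Let rge0 := @rw_rate_ge0 R V e d.
Let qsym := @ex_rate_sym R V e d k.
Let qge0 := @ex_rate_ge0 R V e d k.

Let kn : (k <= #|V|)%N.
Proof. by apply: leq_trans k2n; exact: leq_addr. Qed.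

Let n_gt0 : 0 < n.
Proof. by rewrite ltr0n (leq_trans k_gt0). Qed.

Let V2 : (1 < #|V|)%N.
Proof. exact: leq_trans (leq_add k_gt0 k_gt0) k2n. Qed.

Let V_gt0 : (0 < #|V|)%N := ltnW V2.

Let mkS (A : {set V}) (cA : #|A| = k) : S :=
  exist (fun B : {set V} => #|B| == k) A (introT eqP cA).

Lemma ex_tv_pair A A' : \sum_B `|transition qx t A B - transition qx t A' B| <= 1.
Proof.
have := ex_mixed A; have := ex_mixed A'; rewrite /tv_dist => h' h.
apply: (@le_trans _ _ (\sum_B (`|transition qx t A B - unif R B| +
    `|transition qx t A' B - unif R B|))).
  rewrite ler_sum // => B _; rewrite (distrC (transition qx t A' B)).
  exact: ler_distD.
rewrite big_split /=; move: h h'; set u := \sum_B _; set v := \sum_B _; lra.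
Qed.

(** Compare [A] with another starting set [A'].  Their laws at time [t] overlap,
    so their mean sums differ by at most a few standard deviations, which
    [ex_variance] bounds.  [A'] is a set where the combination
    [P2 + mu / 4 * P1] is at most its average, so that a large variance from
    [A'] can only come with a mean on the other side of 0; completing the square
    then gives the bound without a case distinction. *)
Lemma ex_mean_bound f (A : S) : expect f = 0 ->
  occupied_sum (semigroup r t f) A ^+ 2 <=
  6 * (occupied_sum (semigroup r t (fun x => f x ^+ 2)) A +
       k%:R * expect (fun x => f x ^+ 2)).
Proof.
move=> f0; set P2 := semigroup r t (fun x => f x ^+ 2); set P1 := semigroup r t f.
set mu := occupied_sum P1 A; set K := expect _.
have [|A0 [_ cA0 sel]] := @select_subset R V (fun x => P2 x + mu / 4 * P1 x) k [set: V].
  by rewrite cardsT.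
pose A' := mkS cA0.
have {sel} : occupied_sum P2 A' + mu / 4 * occupied_sum P1 A' <= k%:R * K.
  have e1 : occupied_sum P2 A' + mu / 4 * occupied_sum P1 A' =
      \sum_(a in A0) (P2 a + mu / 4 * P1 a).
    by rewrite /occupied_sum mulr_sumr -big_split.
  have e2 : \sum_(a in [set: V]) (P2 a + mu / 4 * P1 a) = n * K.
    rewrite (eq_bigl xpredT) => [|x]; last by rewrite finset.in_setT.
    rewrite big_split /= -mulr_sumr !expect_sum ?(leq_trans k_gt0) //.
    by rewrite !(expect_semigroup rsym) f0 /K; ring.
  by rewrite e1 -(ler_pM2l n_gt0); move: sel; rewrite cardsT e2; lra.
have := ex_variance graph f A t_ge0; have := ex_variance graph f A' t_ge0.
rewrite -/P1 -/P2 => v' v sel.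
have := overlap_mean (transition_ge0 qsym qge0 A ^~ t_ge0)
  (transition_ge0 qsym qge0 A' ^~ t_ge0) (transition_sum1 qsym t A)
  (transition_sum1 qsym t A') (ex_tv_pair A A') v v'.
rewrite -/mu; move: sel; set x := occupied_sum P1 A'.
set W := occupied_sum P2 A; set W' := occupied_sum P2 A'.
have := sqr_ge0 (x - mu / 2).
have W0 : 0 <= W.
  rewrite /W sumr_ge0 // => y _; rewrite sumr_ge0 // => z _.
  by rewrite mulr_ge0 ?sqr_ge0 // transition_ge0.
have K0 : 0 <= k%:R * K by rewrite mulr_ge0 // expect_ge0 // => y; exact: sqr_ge0.
move: K0; set K' := k%:R * K => K0.
have -> : (x - mu / 2) ^+ 2 = x ^+ 2 - mu * x + mu ^+ 2 / 4 by field.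
have -> : (mu - x) ^+ 2 = mu ^+ 2 - 2 * (mu * x) + x ^+ 2 by ring.
have -> : mu / 4 * x = (mu * x) / 4 by field.
lra.
Qed.

(** Since [k <= n / 2] there is a disjoint [k]-set.  The two occupation
    probabilities of [x] add up to at most 1, and differ by at most 1/2. *)
Lemma ex_hit (A : {set V}) x : #|A| = k ->
  \sum_(y in A) transition r t x y <= 3 / 4.
Proof.
move=> cA.
have [|A0 [sA0 cA0 _]] := @select_subset R V (fun _ => 0) k (~: A).
  by rewrite -(leq_add2l #|A|) cardsC cA.
pose ind (y : V) : R := (y == x)%:R.
have E (B : {set V}) (cB : #|B| = k) :
    semigroup qx t (occupied_sum ind) (mkS cB) = \sum_(y in B) transition r t x y.
  rewrite (ex_semigroup_occupied_sum graph) /occupied_sum; apply: eq_bigr => y _.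
  rewrite /semigroup (bigD1 x) //= /ind eqxx mulr1 big1 ?addr0 => [|z zx].
    exact: transition_sym.
  by rewrite (negbTE zx) mulr0.
have ind01 (B : S) : occupied_sum ind B = 0 \/ occupied_sum ind B = 1 :> R.
  case: (boolP (x \in val B)) => xB; [right|left].
    rewrite /occupied_sum (bigD1 x) //= /ind eqxx big1 ?addr0 // => y /andP[_ yx].
    by rewrite (negbTE yx).
  by rewrite /occupied_sum big1 // => y yB; rewrite /ind; case: eqP xB => // <-; rewrite yB.
have diff : \sum_(y in A) transition r t x y - \sum_(y in A0) transition r t x y
    <= 1 / 2.
  rewrite -(E _ cA) -(E _ cA0) -sumrB.
  have -> : \sum_B (transition qx t (mkS cA) B * occupied_sum ind B -
      transition qx t (mkS cA0) B * occupied_sum ind B) =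
     \sum_B (transition qx t (mkS cA) B - transition qx t (mkS cA0) B) *
        (occupied_sum ind B - 1 / 2).
    rewrite [RHS](eq_bigr (fun B => (transition qx t (mkS cA) B * occupied_sum ind B -
      transition qx t (mkS cA0) B * occupied_sum ind B) + (transition qx t (mkS cA0) B / 2 -
       transition qx t (mkS cA) B / 2))) => [|B _]; last by field.
    rewrite [RHS]big_split /= [X in _ + X]sumrB -!mulr_suml !(transition_sum1 qsym).
    by rewrite subrr addr0.
  apply: (@le_trans _ _ (\sum_B `|transition qx t (mkS cA) B -
      transition qx t (mkS cA0) B| * (1 / 2))).
    rewrite ler_sum // => B _; apply: le_trans (ler_norm _) _; rewrite normrM.
    rewrite ler_wpM2l // ler_norml.
    by case: (ind01 B) => ->; lra.
  by rewrite -mulr_suml; have := ex_tv_pair (mkS cA) (mkS cA0); lra.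
have tot : \sum_(y in A) transition r t x y + \sum_(y in A0) transition r t x y <= 1.
  rewrite -[leRHS](transition_sum1 rsym t x) [leRHS](bigID [in A]) /= lerD2l.
  rewrite [leRHS](bigID [in A0]) /= -[leLHS]addr0 lerD //.
    rewrite le_eqVlt; apply/orP; left; apply/eqP; apply: eq_bigl => y.
    case: (boolP (y \in A0)) => yA0; rewrite ?andbF ?andbT //.
    by have := fintype.subsetP sA0 y yA0; rewrite inE.
  by rewrite sumr_ge0 // => y _; exact: transition_ge0.
lra.
Qed.

(* 768 = 12 * 8 ^ 2 is where [(k / 8) ^ 2] exceeds the bound [12 * k] that
   [ex_mean_bound] gives for a centered indicator. *)
Hypothesis k_big : (768 < k)%N.

(** From fewer than [k] starting points the probability of being in [B] at time
    [t] is more than 1/8 above the stationary one: [k] such points would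
    contradict [ex_mean_bound].  At time [t] the walk from [x] avoids these exceptional
    points with probability at least 1/4, by [ex_hit], and then runs for a
    second time interval [t]. *)
Lemma rw_overlap (B : {set V}) x :
  semigroup r (t + t) (centered R B) x <= 7 / 8.
Proof.
set f := centered R B.
pose D := [set a | 1 / 8 < semigroup r t f a].
have one1 g y : (forall z, g z <= 1) -> semigroup r t g y <= 1.
  move=> g1; rewrite -[leRHS](semigroup_cst rsym t 1 y).
  exact: le_semigroup.
have Dk : (#|D| < k)%N.
  rewrite ltnNge; apply/negP => kD.
  have [A [sA cA _]] := @select_subset R V (fun _ => 0) k D kD.
  have := ex_mean_bound (mkS cA) (expect_centered R V_gt0 B).
  have : k%:R / 8 <= occupied_sum (semigroup r t f) (mkS cA).
    rewrite /occupied_sum /= -cA -[_%:R]mulr1 -mulrA mulr_natl -sumr_const ler_sum //= => a aA.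
    by have := fintype.subsetP sA a aA; rewrite inE; lra.
  have : occupied_sum (semigroup r t (fun y => f y ^+ 2)) (mkS cA) <= k%:R.
    rewrite /occupied_sum /= -[in leRHS]cA -sumr_const ler_sum //= => a _.
    by apply: one1 => y; exact: centered_sqr_le1.
  have := expect_centered_sqr_le1 R V_gt0 B.
  move=> /(ler_wpM2l (ler0n R k)); rewrite mulr1.
  move: k_big; rewrite -(ltr_nat R); move: (k%:R : R) => K kb.
  set u := K * _; set v := occupied_sum _ _; set w := occupied_sum _ _ => h1 h2 h3 h4.
  have : (K / 8) ^+ 2 <= w ^+ 2 by rewrite lerXn2r // nnegrE; lra.
  nra.
have [A [sA cA]] := exists_superset (ltnW Dk) kn.
rewrite semigroup_add //.
apply: (@le_trans _ _ (semigroup r t (fun y => 1 / 8 + (y \in A)%:R) x)).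
  apply: le_semigroup => // y.
  case: (boolP (y \in A)) => yA /=.
    by have := one1 f y (centered_le1 R V_gt0 B); lra.
  have : y \notin D by apply: contra yA; exact: (fintype.subsetP sA).
  by rewrite inE -leNgt addr0.
rewrite semigroupD semigroup_cst // semigroup_indicator.
by have := ex_hit x cA; lra.
Qed.

(** A law at total variation distance at most 7/8 from the uniform one has a
    part of mass 1/8 with density at most 1; only the rest can feel the maximum
    of [h] rather than its average. *)
Lemma rw_contract (h : V -> R) M x : (forall y, 0 <= h y <= M) ->
  semigroup r (t + t) h x <= expect h + 7 / 8 * M.
Proof.
move=> hM; pose B := [set y | n^-1 < transition r (t + t) x y].
have M0 : 0 <= M by have /andP[] := hM x; exact: le_trans.
have := rw_overlap B x => /(ler_wpM2r M0).
rewrite semigroup_centered // mulr_suml => le.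
apply: (@le_trans _ _ (expect h + \sum_(y in B) (transition r (t + t) x y - n^-1) * M)).
  rewrite /expect /unif [X in _ <= _ + X]big_mkcond -big_split ler_sum //= => y _.
  have /andP[h0 hM'] := hM y; rewrite inE; case: ltrP => ty.
    have := ler_wpM2l (_ : 0 <= transition r (t + t) x y - n^-1) hM'.
    by rewrite subr_ge0 ltW // => /(_ isT); lra.
  by rewrite addr0 ler_wpM2r.
by rewrite lerD2l.
Qed.

Lemma rw_contract_iter (h : V -> R) M N x : (forall y, 0 <= h y <= M) ->
  semigroup r ((t + t) *+ N) h x <= 8 * expect h + (7 / 8) ^+ N * M.
Proof.
move=> hM; have Eh : 0 <= expect h by apply: expect_ge0 => y; have /andP[] := hM y.
elim: N x => [|N IH] x.
  rewrite mulr0n semigroup0 // expr0 mul1r; have /andP[_] := hM x; lra.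
rewrite mulrS semigroup_add //.
have tt : 0 <= (t + t) *+ N by rewrite mulrn_wge0 // addr_ge0.
have h0 y : 0 <= semigroup r ((t + t) *+ N) h y.
  by rewrite sumr_ge0 // => z _; rewrite mulr_ge0 ?transition_ge0 //; have /andP[] := hM z.
have := @rw_contract (semigroup r ((t + t) *+ N) h)
  (8 * expect h + (7 / 8) ^+ N * M) x.
rewrite expect_semigroup // exprS => le; apply: le_trans (le _) _; last by lra.
by move=> y; rewrite h0 IH.
Qed.

(** Letting the variance decay during [s] makes a centered indicator small on
    average, though perhaps not everywhere; [rw_contract_iter] then turns the
    average of its absolute value into a bound from every starting point. *)
Lemma rw_mixed (s : R) : 0 <= s -> 64 <= expR (gap r * s) ->
  forall x, tv_dist (transition r ((t + t) *+ 16 + s) x) (@unif R V) <= 1 / 4.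
Proof.
move=> s0 es x; have tt : 0 <= (t + t) *+ 16 by rewrite mulrn_wge0 // addr_ge0.
apply: tv_dist_transition_le => // B; set f := centered R B.
set g := semigroup r s f.
have g1 y : 0 <= `|g y| <= 1.
  rewrite normr_ge0 /= /g; apply: le_trans (ler_norm_sum _ _ _) _.
  rewrite -[leRHS](transition_sum1 rsym s y) ler_sum // => z _.
  rewrite normrM ger0_norm ?transition_ge0 // ler_piMr ?transition_ge0 //.
  exact: norm_centered_le1.
pose eta := expR (- gap r * s).
have eta0 : 0 < eta by exact: expR_gt0.
have eta64 : eta <= 1 / 64.
  rewrite /eta mulNr expRN div1r lef_pV2 // posrE ?expR_gt0 //.
have Eg : expect (fun y => `|g y|) <= eta.
  have dec : expect (fun y => g y ^+ 2) <= eta ^+ 2.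
    apply: le_trans (semigroup_decay _ _ _ _ _ _) _ => //.
    - exact: rw_irreducible.
    - exact: expect_centered.
    - by rewrite -/eta ler_piMr ?sqr_ge0 // expect_centered_sqr_le1.
  have : expect (fun y => `|g y|) <= expect (fun y => (2 * eta)^-1 * (g y ^+ 2 + eta ^+ 2)).
    apply: le_expect => y; rewrite mulrC ler_pdivlMr ?mulr_gt0 //.
    have := sqr_ge0 (`|g y| - eta); rewrite sqrrB real_normK ?num_real //; lra.
  rewrite expectZ expectD expect_cst // => le; apply: le_trans le _.
  rewrite mulrC ler_pdivrMr ?mulr_gt0 //; move: dec; rewrite !expr2; lra.
rewrite semigroup_add // -/g.
apply: (@le_trans _ _ (semigroup r ((t + t) *+ 16) (fun y => `|g y|) x)).
  by apply: le_semigroup => // y; exact: ler_norm.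
apply: le_trans (rw_contract_iter 16 x g1) _.
have := expr16_7_8_le R; move: Eg eta64; move: (_ ^+ 16) (expect _) => c E; lra.
Qed.

End ExclusionMixed.

(** * Lower bound by the relaxation time *)

(** If [U] has at least [k] points, choose inside it the [k]-set where [phi] is
    smallest.  Otherwise [A] contains [U]; the other points are chosen so that
    their average of [f] is at least that of [f] over [~: U], and since [f] has
    mean 0 and [k <= n / 2] they destroy at most half of the sum over [U]. *)
Lemma spread_subset (R : realType) (V : finType) (f phi : V -> R) (k : nat)
    (U : {set V}) :
  expect f = 0 -> (forall x, x \in U -> 1 / 4 <= f x) ->
  (forall x, 0 <= phi x) -> expect phi = 1 -> (0 < #|U|)%N -> (k + k <= #|V|)%N ->
  exists A : {set V}, [/\ #|A| = k, (minn k #|U|)%:R / 8 <= \sum_(x in A) f x &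
    #|U|%:R * \sum_(x in A) phi x <= #|V|%:R * (minn k #|U|)%:R].
Proof.
move=> f0 fU phi0 phi1 U0 k2n.
have V0 : (0 < #|V|)%N by apply: leq_trans U0 (max_card _).
have phi_le (A : {set V}) : \sum_(x in A) phi x <= #|V|%:R.
  have <- : \sum_x phi x = #|V|%:R by rewrite expect_sum // phi1 mulr1.
  rewrite big_mkcond ler_sum // => x _.
  by case: ifP.
have [kU|Uk] := leqP k #|U|.
  have [A [sA cA sel]] := select_subset phi kU.
  exists A; split => //.
    have : k%:R * (1 / 4) <= \sum_(x in A) f x.
      rewrite -{1}cA mulr_natl -sumr_const ler_sum // => x xA.
      by apply: fU; exact: (fintype.subsetP sA).
    have : 0 <= k%:R :> R by [].
    by set s := \sum_(x in A) _; lra.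
  apply: le_trans sel _; rewrite mulrC ler_wpM2r //.
have cUC : (#|U| + #|~: U| = #|V|)%N by exact: cardsC.
have kU : (k - #|U| <= #|~: U|)%N.
  rewrite leq_subLR cUC; apply: leq_trans k2n; exact: leq_addr.
have [A1 [sA1 cA1 sel]] := select_subset (fun x => - f x) kU.
have dis : [disjoint U & A1] by rewrite disjoint_sym finset.disjoints_subset.
exists (U :|: A1); split.
- rewrite cardsU (disjoint_setI0 dis) cards0 subn0 cA1 subnKC //; exact: ltnW.
- have -> : \sum_(x in U :|: A1) f x = \sum_(x in U) f x + \sum_(x in A1) f x.
    by rewrite -bigU //; apply: eq_bigl => x; rewrite !inE.
  move: sel; rewrite !sumrN.
  have Utot : \sum_(x in U) f x + \sum_(x in ~: U) f x = 0.
    have : \sum_x f x = 0 by rewrite expect_sum // f0 mulr0.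
    rewrite (bigID [in U]) /= => tot; rewrite -[RHS]tot.
    by congr (_ + _); apply: eq_bigl => x; rewrite inE.
  have FU : #|U|%:R * (1 / 4) <= \sum_(x in U) f x.
    by rewrite mulr_natl -sumr_const ler_sum.
  move: Utot FU; set F := \sum_(x in U) _; set F1 := \sum_(x in A1) _.
  set F2 := \sum_(x in ~: U) _ => Utot FU.
  have -> : - F2 = F by lra.
  have c0 : 0 < #|~: U|%:R :> R.
    rewrite ltr0n -(ltn_add2l #|U|) addn0 cUC (leq_trans Uk) //.
    by apply: leq_trans k2n; exact: leq_addr.
  have eV : #|V|%:R = #|U|%:R + #|~: U|%:R :> R by rewrite -natrD cUC.
  have k2 : k%:R + k%:R <= #|V|%:R :> R by rewrite -natrD ler_nat.
  rewrite natrB ?(ltnW Uk) // => sel.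
  have U0' : 0 < #|U|%:R :> R by rewrite ltr0n.
  move: k2; rewrite eV => k2.
  rewrite -(ler_pM2l c0).
  move: sel FU c0 U0' k2; move: (#|~: U|%:R : R) (#|U|%:R : R) (k%:R : R) => c u K.
  move=> sel FU c0 U0' k2.
  have F0 : 0 <= F by lra.
  have : (2 * K - c - u) * F <= 0 by rewrite mulr_le0_ge0 //; lra.
  have : u * c <= 4 * F * c by rewrite ler_pM2r //; lra.
  have : 0 <= u * F by rewrite mulr_ge0 // ltW.
  lra.
- by rewrite mulrC ler_wpM2r.
Qed.

Lemma expR_gt_const (R : realType) (y : R) : 400 <= y -> 16 * 768 < expR y.
Proof.
move=> y400; have -> : y = 2 * (y / 2) by lra.
rewrite expRM_natl expr2; have := expR_ge1Dx (y / 2).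
set Y := expR _ => Yge; have Y200 : 200 <= Y by lra.
have : 200 * 200 <= Y * Y by apply: ler_pM; rewrite ?ler0n.
move: (Y * Y) => Y2; lra.
Qed.

Section LowerBounds.
Variables (R : realType) (V : finType) (e : rel V) (d : nat).
Hypothesis graph : connected_regular_graph e d.
Variables (k : nat) (t : R).
Local Notation r := (rw_rate R e d).
Local Notation S := {A : {set V} | #|A| == k}.
Local Notation qx := (@ex_rate R V e d k).
Local Notation n := (#|V|%:R : R).
Hypothesis t_ge0 : 0 <= t.
Hypothesis ex_mixed : forall A, tv_dist (transition qx t A) (@unif R _) <= 1 / 4.
Hypothesis k2n : (k + k <= #|V|)%N.
Hypothesis k_gt0 : (0 < k)%N.

(** Start exclusion from the set given by [spread_subset].  The mean of the sum
    of the eigenfunction decays only like [expR (- gap r * t)], and must by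
    time [t] have come within a few standard deviations of 0. *)
Lemma spread_bound f (U : {set V}) :
  expect f = 0 -> expect (fun x => f x ^+ 2) = 1 ->
  (forall x, gen r f x = - gap r * f x) ->
  (forall x, x \in U -> 1 / 4 <= f x) -> (0 < #|U|)%N ->
  #|U|%:R * (minn k #|U|)%:R <= 768 * n * expR (2 * (gap r * t)).
Proof.
move=> f0 f1 fe fU U0.
have V0 : (0 < #|V|)%N by apply: leq_trans U0 (max_card _).
pose phi := semigroup r t (fun x => f x ^+ 2).
have phi0 x : 0 <= phi x.
  rewrite sumr_ge0 // => y _; rewrite mulr_ge0 ?sqr_ge0 // transition_ge0 //.
    exact: rw_rate_sym.
  exact: rw_rate_ge0.
have phi1 : expect phi = 1 by rewrite expect_semigroup //; exact: rw_rate_sym.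
have [A [cA FA phiA]] := spread_subset f0 fU phi0 phi1 U0 k2n.
pose A' : S := exist (fun B : {set V} => #|B| == k) A (introT eqP cA).
have := ex_mean_bound graph t_ge0 ex_mixed k2n k_gt0 A' f0.
rewrite f1 mulr1 (eq_occupied_sum _ (semigroup_eigen (rw_rate_sym R graph) t fe)) occupied_sumZ.
rewrite -/phi -[occupied_sum phi A']/(\sum_(x in A) phi x).
rewrite -[occupied_sum f A']/(\sum_(x in A) f x).
move: FA phiA; set F := \sum_(x in A) f x; set W := \sum_(x in A) phi x.
have kap_gt0 : (0 < minn k #|U|)%N by rewrite leq_min k_gt0.
have kk : #|U|%:R * k%:R <= n * (minn k #|U|)%:R :> R.
  rewrite -!natrM ler_nat.
  have Un := max_card [in U]; have kn := leq_trans (leq_addr k k) k2n.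
  by case: (leqP k #|U|) => _; [|rewrite (mulnC #|U|)]; rewrite leq_mul2r ?Un ?kn orbT.
have kp : 0 < (minn k #|U|)%:R :> R by rewrite ltr0n.
have mp : 0 < #|U|%:R :> R by rewrite ltr0n.
move: kk kp mp; set kap : R := (minn k _)%:R; set m : R := #|U|%:R.
set K : R := k%:R => kk kp mp FA phiA le.
have -> : expR (2 * (gap r * t)) = (expR (t * - gap r) ^+ 2)^-1.
  by rewrite -expRM_natl -expRN; congr expR; ring.
have a0 : 0 < expR (t * - gap r) by exact: expR_gt0.
move: le a0; set a := expR _ => le a0.
rewrite ler_pdivlMr ?exprn_gt0 // -(ler_pM2r kp).
have : (a * (kap / 8)) ^+ 2 <= (a * F) ^+ 2.
  have ak : 0 <= a * (kap / 8) by rewrite mulr_ge0 ?divr_ge0 // ltW.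
  have aF : a * (kap / 8) <= a * F by rewrite ler_pM2l.
  by rewrite lerXn2r // nnegrE // (le_trans ak).
move=> /le_trans /(_ le) /(ler_wpM2l (ltW mp)).
have -> : m * (a * (kap / 8)) ^+ 2 = m * kap * a ^+ 2 * kap / 64 by field.
lra.
Qed.

(** The role of [l] is played by [delta * ln n].  Both [k] and [#|U|] are at
    least of order [expR (5 * l)], up to the factor [expR (4 * H + 1)] lost in
    [#|U|]; if [gap r * t < l / 4], the factor [expR (2 * (gap r * t))] of
    [spread_bound] is too small to compensate. *)
Lemma relaxation_lower_bound (H l : R) : 0 < H -> H = l / 400 -> 400 <= l ->
  gap r <= H * logsob r -> expR (5 * l) <= k%:R -> expR (5 * l) <= n ->
  l / 4 <= gap r * t.
Proof.
move=> H0 Hl l1 gH kl nl.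
have V2 : (1 < #|V|)%N := leq_trans (leq_add k_gt0 k_gt0) k2n.
have [f [f0 f1 fe spread]] := spread_eigenfunction V2 (rw_rate_sym R graph)
  (@rw_rate_ge0 R V e d) (rw_irreducible graph) H0 gH.
move: spread; set U := [set x | _]; set E := expR (4 * H + 1) => spread.
have E0 : 0 < E by exact: expR_gt0.
have n0 : 0 < n by rewrite ltr0n ltnW.
have U0 : (0 < #|U|)%N.
  rewrite lt0n; apply/negP => /eqP U0; move: spread; rewrite U0 mulr0; lra.
have fU x : x \in U -> 1 / 4 <= f x by rewrite inE.
have sb := spread_bound f0 f1 fe fU U0.
rewrite leNgt; apply/negP => lt.
set T := expR (2 * (gap r * t)) in sb.
have Tl : T <= expR (l / 2) by rewrite ler_expR; lra.
have T0 : 0 < T by exact: expR_gt0.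
have mp : 0 < #|U|%:R :> R by rewrite ltr0n.
have kap : (minn k #|U|)%:R <= 4 * 768 * E * T.
  rewrite -(ler_pM2l mp); apply: le_trans sb _.
  have := ler_wpM2l (ltW T0) spread; lra.
have E1 : 1 <= E by rewrite -expR0 ler_expR; lra.
have main : expR (5 * l) <= 16 * 768 * E ^+ 2 * T.
  have ET0 : 0 < E * T by rewrite mulr_gt0.
  have EET : E * T <= E * (E * T) by rewrite ler_peMl // ltW.
  have [kU|Uk] := leqP k #|U|.
    move: kap; rewrite (minn_idPl kU) expr2 => kap.
    apply: le_trans kl _; apply: le_trans kap _; lra.
  move: kap; rewrite (minn_idPr (ltnW Uk)) expr2 => kap.
  apply: le_trans nl _.
  have := ler_wpM2l (ltW E0) kap; lra.
have : expR (5 * l) <= 16 * 768 * expR (2 * (4 * H + 1) + l / 2).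
  apply: le_trans main _; rewrite expRD expRM_natl -/E -mulrA.
  apply: ler_wpM2l; first by rewrite mulr_ge0 ?ler0n.
  by apply: ler_wpM2l => //; rewrite exprn_ge0 // ltW.
have -> : 5 * l = (5 * l - (2 * (4 * H + 1) + l / 2)) + (2 * (4 * H + 1) + l / 2).
  by lra.
rewrite expRD ler_pM2r ?expR_gt0 // => ub.
have big : 400 <= 5 * l - (2 * (4 * H + 1) + l / 2) by lra.
by have := expR_gt_const big; move: ub; set X := expR _; lra.
Qed.

End LowerBounds.

(** * Conclusion *)

Theorem corollary1p10 (R : realType) :
  exists c c' : R, [/\ 0 < c, 0 < c' &
    forall (V : nat -> finType) (e : forall m, rel (V m)) (d : nat -> nat),
    (forall m, connected_regular_graph (e m) (d m)) ->
    (forall m p : nat, (m < p)%N -> (#|V m| < #|V p|)%N) ->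
    forall delta : nat -> R,
    (forall m, 0 < delta m < 1 / 5) ->
    (forall m, 1 / logsob (rw_rate R (e m) (d m)) <=
       c * delta m * trel (rw_rate R (e m) (d m)) * ln (#|V m|%:R)) ->
    forall m k : nat,
    (#|V m|%:R : R) `^ (5 * delta m) <= k%:R ->
    (k%:R : R) <= #|V m|%:R / 2 ->
    c' * Num.max (tmix (rw_rate R (e m) (d m)))
                 (delta m * trel (rw_rate R (e m) (d m)) * ln (#|V m|%:R))
      <= tmix (@ex_rate R (V m) (e m) (d m) k)].
Proof.
(* With [c = 1/400] the hypothesis forces [delta * ln n >= 400], which makes all
   numerical factors negligible.  The mixing time of the walk will be at most
   [32 * t + 64 * trel], and [64 * trel <= t]: hence [c' = 1/33]. *)
exists (1 / 400), (1 / 33); split; [lra|lra|].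
move=> V e d graphs _ delta deltas hls m k k_low k_high.
have graph := graphs m; have /andP[d0 d5] := deltas m; have ls := hls m.
move: (V m) (e m) (d m) (delta m) graph d0 d5 ls k_low k_high.
move=> {}V {}e {}d {}delta {graphs deltas hls m} graph d0 d5 ls k_low k_high.
set r := rw_rate R e d in ls *; set n : R := #|V|%:R in ls k_low k_high *.
have V0 : (0 < #|V|)%N by case: graph.
have n1 : 1 <= n by rewrite ler1n.
have n0 : 0 < n by lra.
set l := delta * ln n.
have powE : n `^ (5 * delta) = expR (5 * l).
  by rewrite /powR gt_eqF // /l mulrA.
have ln0 : 0 <= ln n by exact: ln_ge0.
have l0 : 0 <= l by rewrite mulr_ge0 // ltW.
have k1 : 1 <= k%:R :> R.
  apply: le_trans k_low; rewrite powE; have := expR_ge1Dx (5 * l); lra.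
have k_gt0 : (0 < k)%N by rewrite -(ler1n R).
have k2n : (k + k <= #|V|)%N by rewrite -(ler_nat R) natrD -/n; lra.
have V2 : (1 < #|V|)%N := leq_trans (leq_add k_gt0 k_gt0) k2n.
have rsym := rw_rate_sym R graph.
have rge0 := @rw_rate_ge0 R V e d.
have rirr := @rw_irreducible R V e d graph.
have [_ [g0 _ _ _]] := gap_eigenfunction rsym rge0 V2 rirr.
have L0 := logsob_gt0 V2 rsym rge0 rirr.
have Lg := logsob_le_gap V2 rsym rge0 rirr.
rewrite -/r in g0 L0 Lg.
pose H := l / 400.
have gH : gap r <= H * logsob r.
  move: ls; rewrite /trel ler_pdivrMr // => ls.
  have := ler_wpM2l (ltW g0) ls; rewrite mulr1.
  have -> : gap r * (1 / 400 * delta * (1 / gap r) * ln n * logsob r) = H * logsob r.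
    by rewrite /H /l; field; rewrite gt_eqF.
  done.
have H1 : 1 <= H.
  rewrite -(ler_pM2r g0) mul1r; apply: le_trans gH _.
  by rewrite ler_wpM2l // /H; lra.
have l1 : 400 <= l by move: H1; rewrite /H; lra.
have nl : expR (5 * l) <= n.
  rewrite -[leRHS](lnK (_ : n \in Num.pos)) ?posrE // ler_expR /l mulrA ler_piMl //; lra.
have klow : expR (5 * l) <= k%:R by rewrite -powE.
have k768 : (768 < k)%N.
  rewrite -(ltr_nat R); have := expR_ge1Dx (5 * l); lra.
have S2 := ksubset_card_gt1 k_gt0 k2n.
have qsym := @ex_rate_sym R V e d k.
have qge0 := @ex_rate_ge0 R V e d k.
have [t0 [t00 tmix0]] := exists_mixing_time S2 qsym qge0 (ex_irreducible graph (k:=k)).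
apply: lb_le_inf; first by exists t0.
move=> t [t_ge0 ex_mixed].
have low : l / 4 <= gap r * t.
  apply: (relaxation_lower_bound graph t_ge0 ex_mixed k2n k_gt0 (H := H)) => //; lra.
have lt : delta * trel r * ln n <= 4 * t.
  rewrite (_ : delta * trel r * ln n = l / gap r); last first.
    by rewrite /trel /l; field; rewrite gt_eqF.
  by rewrite ler_pdivrMr //; lra.
pose s := 64 / gap r.
have s0 : 0 <= s by rewrite divr_ge0 // ltW.
have st : s <= t.
  rewrite /s ler_pdivrMr //; lra.
have rw : tmix r <= (t + t) *+ 16 + s.
  apply: ge_inf; first by exists 0 => u [].
  split; first by rewrite addr_ge0 // mulrn_wge0 // addr_ge0.
  apply: (rw_mixed graph t_ge0 ex_mixed k2n k_gt0 k768 s0).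
  rewrite /s mulrC divfK ?gt_eqF //.
  have := expR_ge1Dx (64 : R); lra.
rewrite div1r mulrC ler_pdivrMr; last by lra.
rewrite ge_max; apply/andP; split; last by lra.
by apply: le_trans rw _; rewrite -mulr_natl; lra.
Qed.
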